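(* To each countable ordered set $C$ one can associate a locally solvable subgroup $W_C$ of Thompson's group $F$ that is generated by the signatures of a tower $T$ in $W_C$ which is order isomorphic to $C$, in such a way that for all countable ordered sets $C$ and $D$: $W_C$ and $W_D$ are isomorphic as groups if and only if $C$ and $D$ are order isomorphic.
   Context: ''Ordered set'' means totally ordered set. $I=[0,1]$. $\mathrm{PL}_o(I)$ is the group, under composition, of piecewise linear orientation-preserving homeomorphisms of $I$ with finitely many breakpoints (points of non-differentiability). Thompson's group $F$ is the subgroup of $\mathrm{PL}_o(I)$ of elements whose breakpoints are dyadic rationals and whose slopes are integral powers of $2$. A group is locally solvable if every finitely generated subgroup of it is solvable. An orbital of $f\in \mathrm{PL}_o(I)$ is a maximal (open) interval contained in $\mathrm{Supp}(f)=\{x\in I : (x)f\neq x\}$. A signed orbital is a pair $(A,f)$ with $f\in \mathrm{PL}_o(I)$ and $A$ an orbital of $f$; $f$ is called its signature. A tower in a subgroup $G$ of $\mathrm{PL}_o(I)$ is a set $T$ of signed orbitals with signatures in $G$ such that the orbitals occurring in $T$ form a chain under inclusion and each of these orbitals is assigned exactly one signature; $T$ is totally ordered by inclusion of orbitals. *)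

(* Defs.v *)
From HB Require Import structures.
From mathcomp Require Import all_boot all_order all_algebra.
From mathcomp Require Import all_classical all_reals all_analysis.
From mathcomp Require Import ring lra.

Set Implicit Arguments.
Unset Strict Implicit.
Unset Printing Implicit Defensive.

Import Order.TTheory GRing.Theory Num.Theory.
Import numFieldNormedType.Exports.

Local Open Scope classical_set_scope.
Local Open Scope ring_scope.

Section subgroups.
Variable G : groupType.
Implicit Types H K S : set G.

Definition subgroup H : Prop := group_closed [in H].

Definition generated_subgroup S : set G := smallest subgroup S.

Definition finitely_generated H : Prop :=
  exists2 S, finite_set S & H = generated_subgroup S.

Definition derived_subgroup H : set G :=
  generated_subgroup [set [~ x, y]%g | x in H & y in H].

Definition solvable_subgroup H : Prop :=
  exists n, iter n derived_subgroup H = [set 1%g].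

Definition locally_solvable H : Prop :=
  forall K, subgroup K -> K `<=` H -> finitely_generated K ->
    solvable_subgroup K.

End subgroups.

Definition isomorphic_subgroups (G G' : groupType) (H : set G) (H' : set G') :
    Prop :=
  exists2 f : G -> G',
    set_bij H H' f & {in H &, {morph f : x y / (x * y)%g >-> (x * y)%g}}.

Definition order_isomorphic (d d' : Order.disp_t) (C : orderType d)
    (D : orderType d') : Prop :=
  exists2 f : C -> D, bijective f & {mono f : x y / (x <= y)%O}.

Section PL_homeomorphisms.
Variable R : realType.
Implicit Types f : R -> R.

(* The interior of [0, 1] suffices: the one-sided slopes of a piecewise linear
   map always exist at 0 and 1. *)
Definition breakpoint f : set R :=
  [set x : R | 0 < x < 1 /\ ~ derivable f x 1].

Definition affine_on (A : set R) f : Prop :=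
  exists m c : R, forall x, A x -> f x = m * x + c.

Definition piecewise_linear f : Prop :=
  finite_set (breakpoint f) /\
  forall a b : R, 0 <= a -> a < b -> b <= 1 ->
    `]a, b[ `&` breakpoint f = set0 -> affine_on `[a, b] f.

(* A self-map of [0, 1] is represented by its extension by the identity to the
   whole real line, so that Leibniz equality of representatives is equality of
   maps.  A continuous bijection of [0, 1] is a homeomorphism by compactness. *)
Definition PL_homeo f : Prop :=
  [/\ forall x : R, x \notin `[0, 1] -> f x = x,
      set_bij `[0, 1] `[0, 1] f,
      {within `[0, 1], continuous f},
      {in `[0, 1] &, {homo f : x y / x < y}} &
      piecewise_linear f].

Lemma PL_homeo_mono f : PL_homeo f ->
  [/\ {mono f : x y / x <= y}, f 0 = 0, f 1 = 1 & bijective f].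
Proof.
case=> fid [fun_f inj_f surj_f] _ fmono _.
have fI x : 0 <= x <= 1 -> 0 <= f x <= 1.
  by move=> xI; have := fun_f x; rewrite /= !in_itv/=; exact.
have fN x : ~~ (0 <= x <= 1) -> f x = x.
  by move=> xI; apply: fid; rewrite in_itv.
have sI y : 0 <= y <= 1 -> exists2 x, 0 <= x <= 1 & f x = y.
  move=> yI; have [|x] := surj_f y; first by rewrite /= in_itv.
  by rewrite /= in_itv; exists x.
have homo_f : {homo f : x y / x < y}.
  move=> x y xy.
  have [xI|xI] := boolP (0 <= x <= 1); have [yI|yI] := boolP (0 <= y <= 1).
  - by apply: fmono => //; rewrite in_itv.
  - have fxI := fI x xI; rewrite (fN y)//.
    by move: yI; rewrite negb_and -!ltNge; lra.
  - have fyI := fI y yI; rewrite (fN x)//.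
    by move: xI; rewrite negb_and -!ltNge; lra.
  - by rewrite !fN.
have mono_f : {mono f : x y / x <= y} by exact: le_mono.
have surj y : exists x, f x = y.
  have [yI|yI] := boolP (0 <= y <= 1); last by exists y; exact: fN.
  by have [x _ <-] := sI _ yI; exists x.
split=> //.
- have [x xI x0] := sI 0 ltac:(lra).
  have := fI 0 ltac:(lra) => f0; have : f 0 <= f x by rewrite mono_f; lra.
  lra.
- have [x xI x1] := sI 1 ltac:(lra).
  have := fI 1 ltac:(lra) => f1; have : f x <= f 1 by rewrite mono_f; lra.
  lra.
- pose g y := projT1 (cid (surj y)).
  have gK : cancel g f by move=> y; rewrite /g; case: cid.
  by exists g => // x; apply: (inc_inj mono_f); rewrite gK.
Qed.

Lemma affine_on_derivable f (a b x : R) : affine_on `[a, b] f -> a < x < b ->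
  derivable f x 1.
Proof.
case=> m [c fE] xab.
apply: (@near_eq_derivable _ _ _ (fun y => m * y + c)).
- have /near_in_itvoo : x \in `]a, b[ by rewrite in_itv.
  apply: filterS => y; rewrite in_itv/= => /andP[ay yb].
  by rewrite fE//= in_itv/= !ltW.
- by apply: derivableD => //; apply: derivableM.
Qed.

Lemma affine_on_glue f (a p b : R) : a < p < b -> derivable f p 1 ->
  affine_on `[a, p] f -> affine_on `[p, b] f -> affine_on `[a, b] f.
Proof.
move=> /andP[ap pb]; rewrite /derivable => df [m1 [c1 f1]] [m2 [c2 f2]].
have [l dl] := (cvg_ex _).1 df.
have lm1 : l = m1.
  apply: (cvg_unique _ (cvg_dnbhs_at_left dl)) => //.
  apply: cvg_near_cst; near=> h.
  have h0 : h < 0 by near: h; exact: nbhs_left_lt.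
  have hp : a - p < h by near: h; apply: nbhs_left_gt; lra.
  have hE : h%:A = h :> R by exact: mulr1.
  rewrite hE f1/=; last by rewrite in_itv/=; lra.
  rewrite f1/=; last by rewrite in_itv/=; lra.
  rewrite /GRing.scale/=; field; lra.
have lm2 : l = m2.
  apply: (cvg_unique _ (cvg_dnbhs_at_right dl)) => //.
  apply: cvg_near_cst; near=> h.
  have h0 : 0 < h by near: h; exact: nbhs_right_gt.
  have hp : h < b - p by near: h; apply: nbhs_right_lt; lra.
  have hE : h%:A = h :> R by exact: mulr1.
  rewrite hE f2/=; last by rewrite in_itv/=; lra.
  rewrite f2/=; last by rewrite in_itv/=; lra.
  rewrite /GRing.scale/=; field; lra.
have e1 : f p = m1 * p + c1 by apply: f1; rewrite /= in_itv/= lexx ltW.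
have e2 : f p = m2 * p + c2 by apply: f2; rewrite /= in_itv/= lexx ltW.
have m12 : m1 = m2 by rewrite -lm1 -lm2.
exists m1, c1 => x; rewrite /= in_itv/= => /andP[ax xb].
have [xp|px] := leP x p; first by apply: f1; rewrite /= in_itv/= ax.
rewrite f2/=; last by rewrite in_itv/= ltW.
by rewrite m12 in e1 *; lra.
Unshelve. all: by end_near. Qed.

Definition affine_pieces (s : seq R) f : Prop :=
  forall a b : R, 0 <= a -> a < b -> b <= 1 ->
    (forall x : R, x \in s -> ~~ (a < x < b)) -> affine_on `[a, b] f.

Lemma piecewise_linearP f :
  piecewise_linear f <-> exists s, affine_pieces s f.
Proof.
split=> [[/finite_seqP[s sE] fP]|[s fs]].
  exists s => a b a0 ab b1 sN; apply: fP => //.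
  rewrite sE; apply/seteqP; split=> // x [/=]; rewrite in_itv/= => xab xs.
  by have := sN _ xs; rewrite xab.
have bs : breakpoint f `<=` [set` s].
  move=> x [x01 ndx] /=; apply: contrapT => xs; apply: ndx.
  have [e [e0 x0 x1 eN]] : exists e, [/\ 0 < e, 0 <= x - e, x + e <= 1 &
      forall y, y \in s -> ~~ (x - e < y < x + e)].
    have [d d0 dN] : exists2 d, 0 < d &
        forall y, y \in s -> ~~ (x - d < y < x + d).
      move/negP: xs; elim: s {fs} => [|z s IH]; first by exists 1.
      rewrite inE negb_or => /andP[xz /IH[d d0 dN]].
      have z0 : 0 < `|x - z| by rewrite normr_gt0 subr_eq0.
      exists (Num.min d `|x - z|); first by rewrite lt_min d0.
      move=> y; rewrite inE => /predU1P[->|/dN yd].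
        apply/negP => /andP[l1 l2].
        have : `|x - z| < `|x - z|.
          rewrite [X in X < _]distrC ltr_distl.
          apply/andP; split; [apply: le_lt_trans l1|apply: lt_le_trans l2 _].
          - by rewrite lerD2l lerN2 ge_min lexx orbT.
          - by rewrite lerD2l ge_min lexx orbT.
        by rewrite ltxx.
      apply: contra yd => /andP[l1 l2]; apply/andP; split.
      - by apply: le_lt_trans l1; rewrite lerD2l lerN2 ge_min lexx.
      - by apply: (lt_le_trans l2); rewrite lerD2l ge_min lexx.
    pose e := Num.min d (Num.min x (1 - x)).
    have ed : e <= d by rewrite ge_min lexx.
    have ex : e <= x by rewrite !ge_min lexx orbT.
    have e1x : e <= 1 - x by rewrite !ge_min lexx !orbT.
    exists e; split; try lra; first by rewrite !lt_min d0/=; lra.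
    by move=> y /dN; apply: contra; lra.
  by apply: (affine_on_derivable (fs (x - e) (x + e) _ _ _ eN)); lra.
split; first by apply: sub_finite_set bs _.
move=> a b; have [n] := ubnP (count (fun x : R => a < x < b) s).
elim: n a b => // n IH a b; rewrite ltnS => sn a0 ab b1 nob.
have [/hasP[p ps pab]|/hasPn sN] := boolP (has (fun x : R => a < x < b) s); last first.
  exact: fs.
have dp : derivable f p 1.
  apply: contrapT => ndp.
  have : (`]a, b[ `&` breakpoint f) p.
    by split; rewrite /= ?in_itv//; split=> //; lra.
  by rewrite nob.
have lt_count (c d : R) : a <= c -> d <= b -> ~~ (c < p < d) -> 
      (count (fun x : R => (c < x < d)%R) s < n)%N.
  move=> ac db /negbTE pN; apply: leq_trans sn.
  rewrite !((permP (perm_to_rem ps)) _) /= pN pab add0n add1n ltnS.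
  by apply: sub_count => x /=; lra.
apply: (affine_on_glue pab dp).
- apply: IH; [by apply: lt_count; lra|lra|lra|lra|].
  apply/seteqP; split=> // x [xI bx]; rewrite -nob; split=> //.
  by move: xI; rewrite /= !in_itv/=; lra.
- apply: IH; [by apply: lt_count; lra|lra|lra|lra|].
  apply/seteqP; split=> // x [xI bx]; rewrite -nob; split=> //.
  by move: xI; rewrite /= !in_itv/=; lra.
Qed.

Lemma PL_homeoP f : PL_homeo f <->
  [/\ forall x : R, x \notin `[0, 1] -> f x = x, bijective f,
      {mono f : x y / x <= y} & exists s, affine_pieces s f].
Proof.
split=> [fP|[fid [g fK gK] fmono /piecewise_linearP fPL]].
  have [fmono f0 f1 fbij] := PL_homeo_mono fP.
  by case: fP => fid _ _ _ /piecewise_linearP.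
have finj : injective f by exact: can_inj fK.
have nid x : ~~ (0 <= x <= 1) -> f x = x.
  by move=> xI; apply: fid; rewrite in_itv.
have fI x : (0 <= f x <= 1) = (0 <= x <= 1).
  have [xI|xI] := boolP (0 <= x <= 1); last by rewrite nid// (negbTE xI).
  by apply: contrapT => fxI; have /finj fx := nid _ (introN idP fxI); rewrite fx xI in fxI.
have f01 : f 0 = 0 /\ f 1 = 1.
  split.
  - have := fI 0; have := fI (g 0); rewrite gK => gI; rewrite !lexx !ler01/=.
    move=> f0; have : f 0 <= f (g 0) by rewrite fmono; lra.
    rewrite gK; lra.
  - have := fI 1; have := fI (g 1); rewrite gK => gI; rewrite !lexx !ler01/=.
    move=> f0; have : f (g 1) <= f 1 by rewrite fmono; lra.
    rewrite gK; lra.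
have fsurj : set_surj `[0, 1] `[0, 1] f.
  move=> y /=; rewrite in_itv/= => yI; exists (g y) => //=.
  by rewrite in_itv/= -fI gK.
split=> //.
- split=> //; last by move=> ? ? _ _; exact: finj.
  by move=> x /=; rewrite !in_itv/= fI.
- apply: segment_inc_surj_continuous; first by move=> ? ? _ _; exact: fmono.
  by rewrite f01.1 f01.2.
- by move=> x y _ _; rewrite (leW_mono fmono).
Qed.

Lemma PL_homeo_id : PL_homeo idfun.
Proof.
apply/PL_homeoP; split=> //.
by exists [::] => a b _ _ _ _; exists 1, 0 => x _ /=; rewrite mul1r addr0.
Qed.

Lemma PL_homeo_comp f g : PL_homeo f -> PL_homeo g -> PL_homeo (g \o f).
Proof.
move=> fP gP.
have [fmono f0 f1 [f' fK f'K]] := PL_homeo_mono fP.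
have [gmono g0 g1 _] := PL_homeo_mono gP.
have /PL_homeoP[fid fbij _ [sf fs]] := fP.
have /PL_homeoP[gid gbij _ [sg gs]] := gP.
apply/PL_homeoP; split=> /=.
- by move=> x xI; rewrite (fid x)// gid.
- exact: bij_comp.
- by move=> x y /=; rewrite gmono fmono.
exists (sf ++ map f' sg) => a b a0 ab b1 sN.
have [||||m [c fE]] := fs a b => //.
  by move=> x xs; apply: sN; rewrite mem_cat xs.
have lf := leW_mono fmono.
have [||||m' [c' gE]] := gs (f a) (f b).
- by rewrite -f0 fmono.
- by rewrite lf.
- by rewrite -f1 fmono.
- move=> y ys; rewrite -[y]f'K !lf; apply: sN.
  by rewrite mem_cat map_f ?orbT.
exists (m' * m), (m' * c + c') => x /= xab.
rewrite gE/=; last by move: xab; rewrite !in_itv/= !fmono.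
by rewrite fE//; ring.
Qed.

Lemma PL_homeo_inv f : PL_homeo f ->
  exists g, [/\ PL_homeo g, cancel f g & cancel g f].
Proof.
move=> fP.
have [fmono f0 f1 [g fK gK]] := PL_homeo_mono fP.
have /PL_homeoP[fid fbij _ [sf fs]] := fP.
have gmono : {mono g : x y / x <= y} by move=> x y; rewrite -fmono !gK.
have lg := leW_mono gmono.
have g0 : g 0 = 0 by rewrite -f0 fK.
have g1 : g 1 = 1 by rewrite -f1 fK.
exists g; split=> //; apply/PL_homeoP; split=> //.
- by move=> x xI; rewrite -[in LHS](fid _ xI) fK.
- by exists f.
exists (map f sf) => a b a0 ab b1 sN.
have [||||m [c fE]] := fs (g a) (g b).
- by rewrite -g0 gmono.
- by rewrite lg.
- by rewrite -g1 gmono.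
- move=> y ys; have := sN _ (map_f f ys).
  by rewrite -lg -[_ < b]lg fK.
have Ea : a = m * g a + c.
  by rewrite -fE ?gK//= in_itv/= !gmono lexx ltW.
have Eb : b = m * g b + c.
  by rewrite -fE ?gK//= in_itv/= !gmono lexx ltW.
have m0 : m != 0 by apply/eqP => m0; move: Ea Eb; rewrite m0 !mul0r; lra.
exists m^-1, (- (m^-1 * c)) => y yab.
have -> : y = m * g y + c.
  by rewrite -fE ?gK//=; move: yab; rewrite /= !in_itv/= !gmono.
have -> : g (m * g y + c) = g y.
  congr g; rewrite -fE ?gK//=; by move: yab; rewrite /= !in_itv/= !gmono.
by field.
Qed.

End PL_homeomorphisms.

Record PLo (R : realType) := MkPLo {
  PLo_fun :> R -> R;
  PLo_homeo : PL_homeo PLo_fun }.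

HB.instance Definition _ (R : realType) := gen_eqMixin (PLo R).
HB.instance Definition _ (R : realType) := gen_choiceMixin (PLo R).

Section PLo_group.
Variable R : realType.
Implicit Types f g h : PLo R.

Lemma PLo_eqP f g : (f : R -> R) =1 g -> f = g.
Proof.
case: f g => [f fP] [g gP] /= /funext fg; subst g.
by congr MkPLo; exact: Prop_irrelevance.
Qed.

Definition PLo_one : PLo R := MkPLo (@PL_homeo_id R).

(* Homeomorphisms act on the right: (x)(fg) = ((x)f)g. *)
Definition PLo_mul f g : PLo R :=
  MkPLo (PL_homeo_comp (PLo_homeo f) (PLo_homeo g)).

Let PLo_inv_spec f := cid (PL_homeo_inv (PLo_homeo f)).

Definition PLo_inv f : PLo R :=
  MkPLo (let: And3 h _ _ := projT2 (PLo_inv_spec f) in h).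

Lemma PLo_funK f : cancel f (PLo_inv f).
Proof. by rewrite /=; case: (PLo_inv_spec f) => ? []. Qed.

Lemma PLo_invK f : cancel (PLo_inv f) f.
Proof. by rewrite /=; case: (PLo_inv_spec f) => ? []. Qed.

Lemma PLo_mulA : associative PLo_mul.
Proof. by move=> f g h; exact: PLo_eqP. Qed.

Lemma PLo_mul1 : left_id PLo_one PLo_mul.
Proof. by move=> f; exact: PLo_eqP. Qed.

Lemma PLo_mulr1 : right_id PLo_one PLo_mul.
Proof. by move=> f; exact: PLo_eqP. Qed.

Lemma PLo_mulV : left_inverse PLo_one PLo_inv PLo_mul.
Proof. by move=> f; apply: PLo_eqP => x; exact: PLo_invK. Qed.

Lemma PLo_mulrV : right_inverse PLo_one PLo_inv PLo_mul.
Proof. by move=> f; apply: PLo_eqP => x; exact: PLo_funK. Qed.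

HB.instance Definition _ := isGroup.Build (PLo R)
  PLo_mulA PLo_mul1 PLo_mulr1 PLo_mulV PLo_mulrV.

Lemma PLo_mulE f g x : (f * g)%g x = g (f x).
Proof. by []. Qed.

Lemma PLo_oneE x : (1%g : PLo R) x = x.
Proof. by []. Qed.

End PLo_group.

Section towers.
Variable R : realType.
Implicit Types (f : PLo R) (A B : set R) (G : set (PLo R)).

Definition dyadic : set R :=
  [set x | exists (m : int) (n : nat), x = m%:~R / 2 ^+ n].

Definition ThompsonF : set (PLo R) :=
  [set f : PLo R | breakpoint f `<=` dyadic /\
           forall x : R, 0 < x < 1 -> derivable f x 1 ->
             exists k : int, derive1 f x = (2 : R) ^ k].

Definition Supp f : set R := [set x | x \in `[0, 1] /\ f x <> x].

(* Maximal intervals of the open set [Supp f] are automatically open. *)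
Definition orbital f A : Prop :=
  [/\ A !=set0, is_interval A, A `<=` Supp f &
      forall B, is_interval B -> B `<=` Supp f -> A `<=` B -> B = A].

Definition tower G (T : set (set R * PLo R)) : Prop :=
  [/\ forall A f, T (A, f) -> orbital f A /\ G f,
      forall A f B g, T (A, f) -> T (B, g) -> A `<=` B \/ B `<=` A &
      forall A f g, T (A, f) -> T (A, g) -> f = g].

Definition signatures (T : set (set R * PLo R)) : set (PLo R) := snd @` T.

Definition tower_order_isomorphic (T : set (set R * PLo R))
    (d : Order.disp_t) (C : orderType d) : Prop :=
  exists2 phi : C -> set R * PLo R,
    set_bij setT T phi &
    forall x y, (x <= y)%O <-> (phi x).1 `<=` (phi y).1.

End towers.

(* Main.v *)
(* The group of C is generated by bumps f_c with nested supports A_c, such that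
   f_c has a fundamental domain J_c containing the closure of A_e for all e < c.
   For c above all of E, the group <f_c, f_e (e in E)> is the wreath product of
   <f_e (e in E)> by <f_c>, which gives local solvability.

   C is recovered from the abstract group G as follows.  Consider the normal
   subgroups N of G that are closed under roots and under "y such that
   C_G(x) <= C_G(y)", for x in N.  The elements fixing all translates of the left
   endpoint of A_c form such a subgroup, which contains f_e if and only if e <= c.
   Conversely, let x <> 1 be in such an N, and write x = f_m^k p with p in the base
   of the wreath product.  If k <> 0, the commutator of x with f_e (e < m) is f_e^-1
   times an element supported further to the right, so that its centralizer is
   contained in that of f_e; hence f_e is in N, so is p, and finally f_m.  If
   k = 0, the same argument puts the components of p in N.  Thus each x <> 1
   belongs to the same subgroups N as some f_c, and these are ordered as C. *)

Require Import Defs.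
From mathcomp Require Import all_boot all_order all_algebra.
From mathcomp Require Import all_classical all_reals all_analysis.
From mathcomp Require Import zify ring lra.

Set Implicit Arguments.
Unset Strict Implicit.
Unset Printing Implicit Defensive.

Import Order.TTheory GRing.Theory Num.Theory.
Import numFieldNormedType.Exports.

Local Open Scope classical_set_scope.
Local Open Scope ring_scope.

(** * Subgroups *)

Section subgroup_theory.
Variable G : groupType.
Implicit Types (H K S : set G) (x y : G).

Lemma subgroupP H : subgroup H <->
  [/\ H 1%g, forall x y, H x -> H y -> H (x * y)%g & forall x, H x -> H x^-1%g].
Proof.
split=> [sH|[H1 HM HV]].
  split; first by have [/set_mem] := sH.
  - by move=> x y Hx Hy; apply: set_mem; apply: (group_closedM sH); exact: mem_set.
  - by move=> x Hx; apply: set_mem; apply: (group_closedV sH); exact: mem_set.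
split; first exact: mem_set.
move=> x y /set_mem Hx /set_mem Hy; apply: mem_set; apply: HM => //; exact: HV.
Qed.

Lemma subgroup1 H : subgroup H -> H 1%g.
Proof. by case/subgroupP. Qed.

Lemma subgroupM H x y : subgroup H -> H x -> H y -> H (x * y)%g.
Proof. by case/subgroupP => _ HM _; exact: HM. Qed.

Lemma subgroupV H x : subgroup H -> H x -> H x^-1%g.
Proof. by case/subgroupP => _ _; exact. Qed.

Lemma subgroupX H x n : subgroup H -> H x -> H (x ^+ n)%g.
Proof.
move=> sH Hx; elim: n => [|n IH]; first exact: subgroup1.
by rewrite expgS; exact: subgroupM.
Qed.

Lemma subgroupJ H x y : subgroup H -> H x -> H y -> H (x ^ y)%g.
Proof.
move=> sH Hx Hy; rewrite /conjg.
by apply: subgroupM => //; [exact: subgroupV|exact: subgroupM].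
Qed.

Lemma subgroupR H x y : subgroup H -> H x -> H y -> H [~ x, y]%g.
Proof.
move=> sH Hx Hy; rewrite /commg.
by apply: subgroupM => //; [exact: subgroupV|exact: subgroupJ].
Qed.

Lemma subgroup_set1 : subgroup [set (1 : G)%g].
Proof.
apply/subgroupP; split=> //= [x y -> ->|x ->]; first by rewrite mulg1.
by rewrite invg1.
Qed.

Lemma subgroup_gen S : subgroup (generated_subgroup S).
Proof.
apply/subgroupP; split.
- by move=> H [sH _]; exact: subgroup1.
- move=> x y Sx Sy H SH; have [sH _] := SH.
  by apply: subgroupM => //; [exact: Sx|exact: Sy].
- by move=> x Sx H SH; have [sH _] := SH; apply: subgroupV => //; exact: Sx.
Qed.

Lemma sub_gen S : S `<=` generated_subgroup S.
Proof. by move=> x Sx H [_]; exact. Qed.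

Lemma gen_sub S H : subgroup H -> S `<=` H -> generated_subgroup S `<=` H.
Proof. by move=> sH SH x; apply. Qed.

Lemma gen_mono S S' : S `<=` S' -> generated_subgroup S `<=` generated_subgroup S'.
Proof.
move=> SS'; apply: gen_sub; first exact: subgroup_gen.
by move=> x /SS'; exact: sub_gen.
Qed.

Lemma subgroup_derived H : subgroup (derived_subgroup H).
Proof. exact: subgroup_gen. Qed.

Lemma derived_mono H K : H `<=` K -> derived_subgroup H `<=` derived_subgroup K.
Proof.
move=> HK; apply: gen_mono => _ [x Hx [y Hy <-]].
by exists x; [exact: HK|exists y => //; exact: HK].
Qed.

Lemma iter_derived_mono n H K :
  H `<=` K -> iter n (@derived_subgroup G) H `<=` iter n (@derived_subgroup G) K.
Proof. by move=> HK; elim: n => //= n; exact: derived_mono. Qed.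

Lemma subgroup_iter_derived n H :
  subgroup H -> subgroup (iter n (@derived_subgroup G) H).
Proof. by case: n => //= n _; exact: subgroup_derived. Qed.

Lemma derived_sub H : subgroup H -> derived_subgroup H `<=` H.
Proof.
move=> sH; apply: gen_sub => // _ [x Hx [y Hy <-]]; exact: subgroupR.
Qed.

Lemma commg_swapE x y : [~ x, y]%g = ((y * x)^-1 * (x * y))%g.
Proof. by rewrite /commg /conjg invgM !mulgA. Qed.

Definition zexpg x (i : int) : G :=
  match i with Posz n => (x ^+ n)%g | Negz n => (x ^- n.+1)%g end.

Lemma zexpgS x i : zexpg x (i + 1) = (zexpg x i * x)%g.
Proof.
case: i => [n|[|n]].
- have -> : n%:Z + 1 = n.+1%:Z :> int by lia.
  exact: expgSr.
- by rewrite [in RHS]/= expg1 mulVg.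
- have -> : Negz n.+1 + 1 = Negz n by rewrite !NegzE; lia.
  by rewrite /= [in RHS]expgS invgM mulgVK.
Qed.

Lemma zexpgD x i j : zexpg x (i + j) = (zexpg x i * zexpg x j)%g.
Proof.
elim: j => [|n IH|n IH]; first by rewrite addr0 /= mulg1.
- by rewrite -addn1 PoszD addrA !zexpgS IH mulgA.
- apply: (mulIg x); rewrite -zexpgS -mulgA -zexpgS.
  have -> : - n.+1%:Z + 1 = - n%:Z by lia.
  by rewrite -IH; congr zexpg; lia.
Qed.

Lemma zexpgN x i : zexpg x (- i) = (zexpg x i)^-1%g.
Proof. by apply/esym/mulg1_eq; rewrite -zexpgD subrr. Qed.

Lemma zexpg1 x : zexpg x 1 = x. Proof. exact: expg1. Qed.

Lemma subgroupZX H x i : subgroup H -> H x -> H (zexpg x i).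
Proof.
by move=> sH Hx; case: i => n /=; [|apply: subgroupV => //]; exact: subgroupX.
Qed.

End subgroup_theory.

(** * Action on the line: orbits and supports *)

Section PLo_action.
Variable R : realType.
Implicit Types (f g h : PLo R) (s t : R).

Lemma PLo_le f : {mono f : s t / s <= t}.
Proof. by have [] := PL_homeo_mono (PLo_homeo f). Qed.

Lemma PLo_lt f : {mono f : s t / s < t}.
Proof. exact: leW_mono (PLo_le f). Qed.

Lemma PLo_inj f : injective f.
Proof. exact: inc_inj (PLo_le f). Qed.

Lemma PLo_VK f t : f (f^-1%g t) = t.
Proof. by rewrite -PLo_mulE mulVg. Qed.

Lemma PLo_KV f t : f^-1%g (f t) = t.
Proof. by rewrite -PLo_mulE mulgV. Qed.

Lemma PLo_VE f s t : f s = t -> f^-1%g t = s.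
Proof. by move=> <-; rewrite PLo_KV. Qed.

Lemma PLo_Vfix f t : f t = t -> f^-1%g t = t.
Proof. exact: PLo_VE. Qed.

Lemma PLo_zexpD f i j t : zexpg f (i + j) t = zexpg f j (zexpg f i t).
Proof. by rewrite zexpgD. Qed.

Lemma PLo_Xfix f n t : f t = t -> (f ^+ n)%g t = t.
Proof. by move=> ft; elim: n => // n IH; rewrite expgS PLo_mulE ft. Qed.

Lemma PLo_Xgt f n t : t < f t -> t < (f ^+ n.+1)%g t.
Proof.
move=> tf; elim: n => [|n IH]; first by rewrite expg1.
by rewrite expgSr PLo_mulE; apply: (lt_trans tf); rewrite PLo_lt.
Qed.

(** Orbits of an increasing map are monotone, so a point that returns to its start never moved. This
    makes point stabilizers closed under roots. *)
Lemma PLo_Xfix_inv f n t : (f ^+ n.+1)%g t = t -> f t = t.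
Proof.
case: (ltgtP (f t) t) => // ft fnt.
- have : f^-1%g (f t) < f^-1%g t by rewrite PLo_lt.
  rewrite PLo_KV => /(PLo_Xgt n); rewrite expVgn.
  by rewrite (PLo_Vfix fnt) ltxx.
- by have := PLo_Xgt n ft; rewrite fnt ltxx.
Qed.

Definition supported (A : R -> Prop) : set (PLo R) :=
  [set h | forall t, ~ A t -> h t = t].

Lemma subgroup_supported A : subgroup (supported A).
Proof.
apply/subgroupP; split=> //.
- by move=> f g fA gA t At; rewrite PLo_mulE fA// gA.
- by move=> f fA t At; apply: PLo_Vfix; exact: fA.
Qed.

(** A point outside [A] is fixed, so it is its own only preimage and no point of [A] lands on it. *)
Lemma supported_in A h t : supported A h -> A t -> A (h t).
Proof.
move=> hA At; apply: contrapT => /[dup] /hA/PLo_inj -> //.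
Qed.

End PLo_action.

(** * Wreath products generated by a bump *)

Section blocks.
Variables (R : realType) (f : PLo R) (x y : R).
Hypotheses (xy : x < y) (yf : y <= f x).
Implicit Types (H : set (PLo R)) (s t : R) (i j k : int).

Let J : R -> Prop := fun t => x < t < y.

Let f_ge n : y <= (f ^+ n.+1)%g x.
Proof.
elim: n => [|n IH]; first by rewrite expg1.
rewrite expgSr PLo_mulE; apply: (le_trans yf); rewrite PLo_le.
exact: le_trans (ltW xy) IH.
Qed.

(** As [f] carries [x] to [y] or beyond, so does every positive power ([f_ge]); hence the translates
    of [J] succeed one another from left to right without overlap. *)
Lemma block_lt i j s t : i < j -> J s -> J t -> zexpg f i s < zexpg f j t.
Proof.
move=> ij /andP[_ sy] /andP[xt _].
have [n ->] : exists n : nat, j = n.+1%:Z + i by exists (absz (j - i - 1)%R); lia.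
rewrite PLo_zexpD PLo_lt; apply: (lt_le_trans sy).
by apply: (le_trans (f_ge n)); rewrite PLo_le ltW.
Qed.

Lemma block_inj i j s t : J s -> J t -> zexpg f i s = zexpg f j t -> i = j /\ s = t.
Proof.
move=> Js Jt e; have ij : i = j.
  case: (ltgtP i j) => // ij; first by have := block_lt ij Js Jt; rewrite e ltxx.
  by have := block_lt ij Jt Js; rewrite e ltxx.
by split=> //; rewrite ij in e; exact: PLo_inj e.
Qed.

(* The base of the wreath product of [H] by the cyclic group generated by [f]. *)
Definition wreath_base H : set (PLo R) := [set p |
  (forall i, exists2 h, H h & forall t, J t -> p (zexpg f i t) = zexpg f i (h t)) /\
  exists n : nat, forall t, p t <> t ->
    exists i s, [/\ - n%:Z <= i < n%:Z, J s & t = zexpg f i s]].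

Lemma wreath_base_mono H H' : H `<=` H' -> wreath_base H `<=` wreath_base H'.
Proof.
by move=> HH' p [pH pn]; split=> // i; have [h /HH'] := pH i; exists h.
Qed.

(** The finiteness half of membership in the base, for products, inverses and commutators: one
    window of blocks contains the supports of both [p] and [q]. *)
Lemma wreath_base_near H p q r : wreath_base H p -> wreath_base H q ->
  (forall t, p t = t -> q t = t -> r t = t) ->
  exists n : nat, forall t, r t <> t ->
    exists i s, [/\ - n%:Z <= i < n%:Z, J s & t = zexpg f i s].
Proof.
move=> [_ [n pn]] [_ [m qm]] rpq; exists (n + m)%N => t rt.
have [pt|/pn[i [s [il Js ->]]]] := pselect (p t = t); last first.
  by exists i, s; split=> //; lia.
have [qt|/qm[i [s [il Js ->]]]] := pselect (q t = t); first by case: rt; exact: rpq.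
by exists i, s; split=> //; lia.
Qed.

Lemma subgroup_wreath_base H : subgroup H -> H `<=` supported J ->
  subgroup (wreath_base H).
Proof.
move=> sH HJ; apply/subgroupP; split.
- split=> [i|]; first by exists 1%g => //; exact: subgroup1.
  by exists 0%N.
- move=> p q pP qP; split; last first.
    by apply: (wreath_base_near pP qP) => t pt qt; rewrite PLo_mulE pt.
  move=> i; have [h Hh pE] := pP.1 i; have [h' Hh' qE] := qP.1 i.
  exists (h * h')%g; first exact: subgroupM.
  by move=> t Jt; rewrite !PLo_mulE pE// qE//; apply: supported_in => //; exact: HJ.
- move=> p pP; split; last first.
    by apply: (wreath_base_near pP pP) => t pt _; exact: PLo_Vfix.
  move=> i; have [h Hh pE] := pP.1 i.
  exists h^-1%g; first exact: subgroupV.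
  move=> t Jt; apply: PLo_VE; rewrite pE ?PLo_VK//.
  by apply: supported_in => //; apply: HJ; exact: subgroupV.
Qed.

Lemma wreath_base_conj H p i : wreath_base H p -> wreath_base H (p ^ zexpg f i)%g.
Proof.
move=> [pH [n pn]]; have E t : (p ^ zexpg f i)%g t = zexpg f i (p (zexpg f (- i) t)).
  by rewrite zexpgN.
split=> [j|].
  have [h Hh hE] := pH (j - i); exists h => // t Jt.
  by rewrite E -PLo_zexpD hE// -PLo_zexpD subrK.
exists (n + absz i)%N => t; rewrite E => pt.
have /pn[j [s [jn Js e]]] : p (zexpg f (- i) t) <> zexpg f (- i) t.
  by move=> e; apply: pt; rewrite e -PLo_zexpD addNr.
exists (j + i), s; split=> //; first by lia.
by rewrite PLo_zexpD -e -PLo_zexpD addNr.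
Qed.

Lemma sub_wreath_base H : subgroup H -> H `<=` supported J -> H `<=` wreath_base H.
Proof.
move=> sH HJ h Hh; split=> [i|].
  have [->|i0] := eqVneq i 0; first by exists h.
  exists 1%g; first exact: subgroup1.
  move=> t Jt; apply: HJ => // Jit.
  have [i00 _] := block_inj Jt Jit (erefl : zexpg f i t = zexpg f 0 _).
  by rewrite i00 eqxx in i0.
exists 1%N => t; have [Jt _|nJt ht] := pselect (J t); last by case: ht; exact: HJ.
by exists 0, t.
Qed.

(** Normal form in the wreath product: powers of [f] move to the left past the base, which they
    normalize by [wreath_base_conj]. *)
Lemma gen_wreath_decomp H : subgroup H -> H `<=` supported J ->
  generated_subgroup (f |` H) `<=`
  [set g | exists k p, wreath_base H p /\ g = (zexpg f k * p)%g].
Proof.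
move=> sH HJ; have sP := subgroup_wreath_base sH HJ.
apply: gen_sub; last first.
  move=> g [->|Hg]; first by exists 1, 1%g; rewrite zexpg1 mulg1; split=> //; exact: subgroup1.
  by exists 0, g; rewrite mul1g; split=> //; exact: sub_wreath_base.
apply/subgroupP; split.
- by exists 0, 1%g; split; [exact: subgroup1|rewrite mul1g].
- move=> _ _ [k [p [pP ->]]] [l [q [qP ->]]].
  exists (k + l), (p ^ zexpg f l * q)%g; split.
    by apply: subgroupM => //; exact: wreath_base_conj.
  by rewrite zexpgD /conjg !mulgA mulgK.
- move=> _ [k [p [pP ->]]]; exists (- k), (p^-1 ^ zexpg f (- k))%g; split.
    by apply: wreath_base_conj; exact: subgroupV.
  by rewrite /conjg mulVKg zexpgN invgM.
Qed.

(** Both [a * b] and [b * a] have exponent [k + l] of [f], which cancels in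
    [(b * a)^-1 * (a * b)]. *)
Lemma derived_gen_wreath H : subgroup H -> H `<=` supported J ->
  derived_subgroup (generated_subgroup (f |` H)) `<=` wreath_base H.
Proof.
move=> sH HJ; have sP := subgroup_wreath_base sH HJ.
apply: gen_sub => // _ [g /(gen_wreath_decomp sH HJ)[k [p [pP ->]]]
  [h /(gen_wreath_decomp sH HJ)[l [q [qP ->]]] <-]].
set a := (_ * p)%g; set b := (_ * q)%g.
have ab : (a * b = zexpg f (k + l) * (p ^ zexpg f l * q))%g.
  by rewrite /a /b zexpgD /conjg !mulgA mulgK.
have ba : (b * a = zexpg f (k + l) * (q ^ zexpg f k * p))%g.
  by rewrite /a /b addrC zexpgD /conjg !mulgA mulgK.
rewrite commg_swapE ab ba invgM -mulgA mulKg.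
have cP r m : wreath_base H r -> wreath_base H (r ^ zexpg f m)%g.
  exact: wreath_base_conj.
apply: (subgroupM sP); last by apply: (subgroupM sP) => //; exact: cP.
by apply: (subgroupV sP); apply: (subgroupM sP) => //; exact: cP.
Qed.

(** The base multiplies block by block, so a commutator has on each block the commutator of the
    components. *)
Lemma derived_wreath_base H : subgroup H -> H `<=` supported J ->
  derived_subgroup (wreath_base H) `<=` wreath_base (derived_subgroup H).
Proof.
move=> sH HJ; have sP := subgroup_wreath_base sH HJ.
apply: gen_sub.
  apply: subgroup_wreath_base; first exact: subgroup_derived.
  exact: subset_trans (derived_sub sH) HJ.
move=> _ [p pP [q qP <-]]; split; last first.
  apply: (wreath_base_near pP qP) => t pt qt.
  by rewrite /commg /conjg !PLo_mulE (PLo_Vfix pt) (PLo_Vfix qt) pt qt.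
move=> i; have [h Hh pE] := pP.1 i; have [h' Hh' qE] := qP.1 i.
exists [~ h, h']%g; first by apply: sub_gen; exists h => //; exists h'.
have pE' t : J t -> p^-1%g (zexpg f i t) = zexpg f i (h^-1%g t).
  move=> Jt; apply: PLo_VE; rewrite pE ?PLo_VK//.
  by apply: supported_in => //; apply: HJ; exact: subgroupV.
have qE' t : J t -> q^-1%g (zexpg f i t) = zexpg f i (h'^-1%g t).
  move=> Jt; apply: PLo_VE; rewrite qE ?PLo_VK//.
  by apply: supported_in => //; apply: HJ; exact: subgroupV.
move=> t Jt; rewrite /commg /conjg !PLo_mulE.
have J1 : J (h^-1%g t) by apply: supported_in => //; apply: HJ; exact: subgroupV.
have J2 : J (h'^-1%g (h^-1%g t)).
  by apply: supported_in => //; apply: HJ; exact: subgroupV.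
have J3 : J (h (h'^-1%g (h^-1%g t))) by apply: supported_in => //; exact: HJ.
by rewrite pE'// qE'// pE// qE.
Qed.

Lemma iter_derived_wreath_base n H : subgroup H -> H `<=` supported J ->
  iter n (@derived_subgroup _) (wreath_base H) `<=`
  wreath_base (iter n (@derived_subgroup _) H).
Proof.
move=> sH HJ; elim: n => //= n IH.
apply: (subset_trans (derived_mono IH)); apply: derived_wreath_base.
  exact: subgroup_iter_derived.
apply: subset_trans HJ; elim: n {IH} => //= n IH.
by apply: subset_trans IH; apply: derived_sub; exact: subgroup_iter_derived.
Qed.

(** Induction on the number of blocks: shift the support to blocks of nonnegative index, split off
    the component on [J] itself, and shift the rest back by one. In [h * q] the factor [q] acts only
    to the right of [J], so [h] is the leftmost component. *)
Lemma wreath_base_ind H (P : PLo R -> Prop) :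
  subgroup H -> H `<=` supported J -> P 1%g ->
  (forall p, P (p ^ f)%g -> P p) -> (forall p, P (p ^ f^-1)%g -> P p) ->
  (forall h q, H h -> wreath_base H q ->
     (forall t, q t <> t -> exists i s, [/\ 0 < i, J s & t = zexpg f i s]) ->
     P q -> P (h * q)%g) ->
  forall p, wreath_base H p -> P p.
Proof.
move=> sH HJ P1 Pf PfV PM; have sP := subgroup_wreath_base sH HJ.
have Pn n p : wreath_base H p -> (forall t, p t <> t ->
    exists i s, [/\ 0 <= i < n%:Z, J s & t = zexpg f i s]) -> P p.
  elim: n p => [|n IH] p pP pn.
    suff -> : p = 1%g by [].
    apply: PLo_eqP => t; apply: contrapT => /pn[i [s []]].
    by move=> /andP[i0 /(le_lt_trans i0)]; rewrite ltxx.
  have [h Hh hE] := pP.1 0; have hJ := HJ h Hh; have sJ := subgroup_supported J.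
  have -> : p = (h * (h^-1 * p))%g by rewrite mulVKg.
  set q := (h^-1 * p)%g.
  have qP : wreath_base H q.
    by apply: (subgroupM sP) => //; apply: sub_wreath_base => //; exact: subgroupV.
  have qn t : q t <> t -> exists i s, [/\ 0 < i < n.+1%:Z, J s & t = zexpg f i s].
    rewrite PLo_mulE => qt; have [Jt|nJ] := pselect (J t).
      have := hE (h^-1%g t) (supported_in (subgroupV sJ hJ) Jt).
      by rewrite /= PLo_VK => /qt.
    have : p t <> t by move: qt; rewrite (PLo_Vfix (hJ _ nJ)).
    move=> /pn[i [s [iN Js tE]]]; exists i, s; split=> //.
    have i0 : i != 0 by apply/eqP => i0; apply: nJ; rewrite tE i0.
    by lia.
  clearbody q; apply: PM => //; first by move=> t /qn[i [s [/andP[i0 _] Js tE]]]; exists i, s.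
  apply: PfV; apply: IH.
    by have := wreath_base_conj (-1) qP; rewrite zexpgN zexpg1.
  move=> t qt; have /qn[i [s [iN Js tE]]] : q (f t) <> f t.
    by move=> e; apply: qt; rewrite /conjg invgK !PLo_mulE e PLo_KV.
  exists (i - 1), s; split=> //; first by lia.
  by rewrite addrC -[t](PLo_KV f) tE addrC zexpgD zexpgN zexpg1.
move=> p pP; have [_ [n pn]] := pP.
(* Conjugation by [f ^+ n] moves the window of blocks from [- n <= i < n] to [0 <= i < n + n]. *)
suff : P (p ^ (f ^+ n))%g.
  elim: n {pn} p pP => [|n IH] p pP; first by rewrite conjg1.
  by rewrite expgSr conjgM => /Pf; exact: IH.
apply: (Pn (n + n)%N); first exact: (wreath_base_conj n%:Z pP).
move=> t pt; have /pn[i [s [iN Js tE]]] : p ((f ^+ n)^-1%g t) <> (f ^+ n)^-1%g t.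
  by move=> e; apply: pt; rewrite /conjg !PLo_mulE e PLo_VK.
exists (i + n%:Z), s; split=> //; first by lia.
by rewrite PLo_zexpD -tE PLo_VK.
Qed.

(** A point of a negative block precedes all of [J]; past [x] it would itself belong to [J]. *)
Lemma block_le i s : J s -> i < 0 -> zexpg f i s <= x.
Proof.
move=> Js i0; rewrite leNgt; apply/negP => xu.
have us := block_lt i0 Js Js; have Ju : J (zexpg f i s).
  by rewrite /J xu /=; case/andP: Js => _; exact: lt_trans.
by have := block_lt i0 Js Ju; rewrite ltxx.
Qed.

Lemma wreath_base1 : wreath_base [set 1%g] = [set 1%g].
Proof.
apply/seteqP; split=> [p [pH [n pn]]|_ ->]; last first.
  by split=> [i|]; [exists 1%g|exists 0%N].
apply: PLo_eqP => t; apply: contrapT => pt; have [i [s [_ Js ts]]] := pn t pt.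
by have [h -> /(_ s Js)] := pH i; rewrite -ts; exact: pt.
Qed.

(** One derived step lands in the base and [n] further ones act componentwise, so the derived length
    grows by at most one. *)
Lemma solvable_gen_wreath H : subgroup H -> H `<=` supported J ->
  solvable_subgroup H -> solvable_subgroup (generated_subgroup (f |` H)).
Proof.
move=> sH HJ [n Hn]; exists n.+1; rewrite iterSr; apply/seteqP; split.
  apply: (subset_trans (iter_derived_mono (n := n) (derived_gen_wreath sH HJ))).
  by rewrite -wreath_base1 -Hn; exact: iter_derived_wreath_base.
by move=> _ ->; apply: subgroup1; apply: subgroup_iter_derived; exact: subgroup_derived.
Qed.

End blocks.

(** * Centralizer-closed normal subgroups *)

Section centralizer_closed.
Variable G : groupType.
Implicit Types (H N : set G) (x y z : G).

(** Each clause speaks only of multiplication in [H], so an isomorphism carries this family to the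
    corresponding one ([isom_centralizer_closed]). *)
Definition centralizer_closed H N : Prop :=
  [/\ subgroup N, N `<=` H,
      forall x y, H y -> N x -> N (x ^ y)%g,
      forall x n, H x -> N (x ^+ n.+1)%g -> N x &
      forall x y, N x -> H y ->
        (forall z, H z -> commute z x -> commute z y) -> N y].

(** Comparison of the closures generated by single elements: a preorder visible in the abstract
    group. *)
Definition closure_le H x y : Prop :=
  forall N, centralizer_closed H N -> N y -> N x.

Lemma closure_le_trans H y x z :
  closure_le H x y -> closure_le H y z -> closure_le H x z.
Proof. by move=> xy yz N HN /(yz N HN)/(xy N HN). Qed.

End centralizer_closed.

(** * Transport along an isomorphism *)

Section isomorphism.
Variables (G G' : groupType) (H : set G) (H' : set G') (f : G -> G').
Hypotheses (sH : subgroup H) (sH' : subgroup H').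
Hypotheses (fbij : set_bij H H' f)
  (fM : {in H &, {morph f : x y / (x * y)%g >-> (x * y)%g}}).

Let fH x : H x -> H' (f x). Proof. by case: fbij => + _ _; exact. Qed.

Let finj x y : H x -> H y -> f x = f y -> x = y.
Proof. by case: fbij => _ + _ Hx Hy; apply; exact: mem_set. Qed.

Let fsurj y : H' y -> exists2 x, H x & f x = y.
Proof. by case: fbij => _ _; exact. Qed.

Let fMH x y : H x -> H y -> f (x * y)%g = (f x * f y)%g.
Proof. by move=> Hx Hy; apply: fM; exact: mem_set. Qed.

Let H1 : H 1%g. Proof. exact: subgroup1. Qed.
Let HM x y : H x -> H y -> H (x * y)%g. Proof. exact: subgroupM. Qed.
Let HV x : H x -> H x^-1%g. Proof. exact: subgroupV. Qed.

Lemma isom1 : f 1%g = 1%g.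
Proof. by apply: (mulgI (f 1%g)); rewrite -fMH// !mulg1. Qed.

Lemma isomV x : H x -> f x^-1%g = (f x)^-1%g.
Proof.
by move=> Hx; apply/esym/mulg1_eq; rewrite -fMH ?mulgV ?isom1//; exact: HV.
Qed.

Lemma isomX x n : H x -> f (x ^+ n)%g = (f x ^+ n)%g.
Proof.
move=> Hx; elim: n => [|n IH]; first exact: isom1.
by rewrite !expgS fMH ?IH//; exact: subgroupX.
Qed.

Lemma isomJ x y : H x -> H y -> f (x ^ y)%g = (f x ^ f y)%g.
Proof. by move=> Hx Hy; rewrite /conjg !fMH ?isomV//; auto. Qed.

Lemma isom_commute x y : H x -> H y -> commute (f x) (f y) -> commute x y.
Proof. by move=> Hx Hy; rewrite /commute -!fMH// => /finj; apply; auto. Qed.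

Lemma isom_centralizer_closed N :
  centralizer_closed H N -> centralizer_closed H' (f @` N).
Proof.
move=> [sN NH NJ NX NC]; split.
- apply/subgroupP; split.
  + by exists 1%g; [exact: subgroup1|exact: isom1].
  + move=> _ _ [x Nx <-] [y Ny <-]; exists (x * y)%g; first exact: subgroupM.
    by rewrite fMH//; exact: NH.
  + move=> _ [x Nx <-]; exists x^-1%g; first exact: subgroupV.
    by rewrite isomV//; exact: NH.
- by move=> _ [x Nx <-]; apply: fH; exact: NH.
- move=> _ z /fsurj[y Hy <-] [x Nx <-]; exists (x ^ y)%g; first exact: NJ.
  by rewrite isomJ//; exact: NH.
- move=> _ n /fsurj[x Hx <-] [y Ny]; rewrite -isomX// => e.
  exists x => //; apply: (NX x n) => //.
  by rewrite -(finj _ _ e)//; [exact: NH|exact: subgroupX].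
- move=> _ _ [x Nx <-] /fsurj[y Hy <-] xy; exists y => //.
  apply: (NC x) => // z Hz zx; apply: isom_commute => //.
  apply: xy; first exact: fH.
  by rewrite /commute -!fMH ?zx//; exact: NH.
Qed.

Lemma isom_closure_le x y : H x -> H y ->
  closure_le H' (f x) (f y) -> closure_le H x y.
Proof.
move=> Hx Hy xy N NP Ny; have [_ NH _ _ _] := NP.
have [z Nz /finj e] : (f @` N) (f x).
  by apply: xy; [exact: isom_centralizer_closed|exists y].
by rewrite -e//; exact: NH.
Qed.

Lemma isom_inverse : exists f' : G' -> G,
  [/\ set_bij H' H f', {in H' &, {morph f' : x y / (x * y)%g >-> (x * y)%g}},
      forall x, H x -> f' (f x) = x & forall y, H' y -> f (f' y) = y].
Proof.
have /choice[f' f'P] y : exists x, H' y -> H x /\ f x = y.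
  by have [/fsurj[x Hx <-]|nH] := pselect (H' y); [exists x|exists 1%g].
have f'H y : H' y -> H (f' y) by case/f'P.
have f'K y : H' y -> f (f' y) = y by case/f'P.
have fK x : H x -> f' (f x) = x.
  by move=> Hx; apply: finj; rewrite ?f'K//; [apply: f'H|]; exact: fH.
exists f'; split=> //.
- split=> //.
  + by move=> x y /set_mem Hx /set_mem Hy e; rewrite -(f'K x)// e f'K.
  + by move=> x Hx; exists (f x); [exact: fH|exact: fK].
- move=> x y /set_mem Hx /set_mem Hy; apply: finj; [| |].
  + by apply: f'H; exact: subgroupM.
  + by apply: HM; exact: f'H.
  + by rewrite fMH ?f'K//; [exact: subgroupM|exact: f'H|exact: f'H].
Qed.

End isomorphism.

(** Adding elements in increasing order makes each new bump the top of a wreath product over the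
    group generated so far. *)
Lemma finite_set_max_ind (d : Order.disp_t) (C : orderType d)
    (P : set C -> Prop) : P set0 ->
  (forall m E, finite_set E -> (forall c, E c -> (c < m)%O) -> P E -> P (m |` E)) ->
  forall E, finite_set E -> P E.
Proof.
move=> P0 PS E /finite_seqP[s0 ->].
have [s ss ->] : exists2 s, sorted >%O s & [set` s0] = [set` s].
  exists (rev (sort <=%O (undup s0))).
    by rewrite rev_sorted sort_lt_sorted undup_uniq.
  by apply/seteqP; split=> c /=; rewrite mem_rev mem_sort mem_undup.
elim: s ss => [|m s IH ms]; first by rewrite set_nil.
have -> : [set` m :: s] = m |` [set` s].
  by apply/seteqP; split=> c /=; rewrite inE; [case/predU1P|case=> [->|->]]; tauto || rewrite ?eqxx ?orbT.
apply: PS; first exact: finite_seq.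
- by apply/allP; apply: order_path_min ms => c e g /= ce gc; exact: lt_trans gc ce.
- by apply: IH; exact: path_sorted ms.
Qed.

(** * Groups generated by nested bumps *)

(* []x c, y c[] lies in a fundamental domain of [f c] acting on its support
   []a c, b c[], and contains the supports of all lower elements. *)
Definition bump_tower (R : realType) (d : Order.disp_t) (C : orderType d)
    (f : C -> PLo R) (a x y b : C -> R) : Prop :=
  [/\ forall c, [/\ a c < x c, x c < y c, y c < b c & y c <= f c (x c)],
      forall c t, ~ (a c < t < b c) -> f c t = t,
      forall c t, a c < t < b c -> t < f c t &
      forall c e, (c < e)%O -> x e < a c /\ b c < y e].

Section tower_group.
Variables (R : realType) (d : Order.disp_t) (C : orderType d).
Variables (f : C -> PLo R) (a x y b : C -> R).
Hypothesis fT : bump_tower f a x y b.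
Implicit Types (c e m : C) (E : set C) (g h p q z : PLo R) (s t : R) (i k : int).

Let A c : R -> Prop := fun t => a c < t < b c.
Let J c : R -> Prop := fun t => x c < t < y c.
Let Gen E := generated_subgroup (f @` E).
Let G := generated_subgroup (range f).
Let WB m H := wreath_base (f m) (x m) (y m) H.

Let ax c : a c < x c. Proof. by have [/(_ c)[]] := fT. Qed.
Let xy c : x c < y c. Proof. by have [/(_ c)[]] := fT. Qed.
Let yb c : y c < b c. Proof. by have [/(_ c)[]] := fT. Qed.
Let yf c : y c <= f c (x c). Proof. by have [/(_ c)[]] := fT. Qed.
Let fA c : supported (A c) (f c). Proof. by have [_ + _ _] := fT; exact. Qed.
Let fgt c t : A c t -> t < f c t. Proof. by have [_ _ + _] := fT; exact. Qed.
Let xa c e : (c < e)%O -> x e < a c. Proof. by have [_ _ _ H] := fT; case/H. Qed.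
Let by_ c e : (c < e)%O -> b c < y e. Proof. by have [_ _ _ H] := fT; case/H. Qed.

Let JA c t : J c t -> A c t.
Proof. by rewrite /J /A; have := ax c; have := yb c; lra. Qed.

Let AJ c e t : (c < e)%O -> A c t -> J e t.
Proof. by move=> ce; rewrite /J /A; have := xa ce; have := by_ ce; lra. Qed.

Let Ja c e : (c < e)%O -> J e (a c).
Proof.
move=> ce; rewrite /J; have := xa ce; have := by_ ce; have := ax c; have := xy c.
by have := yb c; lra.
Qed.

Let J0 c : J c ((x c + y c) / 2).
Proof. by rewrite /J; have := xy c; lra. Qed.

Let sGen E : subgroup (Gen E). Proof. exact: subgroup_gen. Qed.
Let sG : subgroup G. Proof. exact: subgroup_gen. Qed.
Let Gf c : G (f c). Proof. by apply: sub_gen; exists c. Qed.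
Let sSJ m : subgroup (supported (J m)). Proof. exact: subgroup_supported. Qed.

Let GenG E : Gen E `<=` G.
Proof. by apply: gen_mono => _ [c _ <-]; exists c. Qed.

Let GenJ m E : (forall c, E c -> (c < m)%O) -> Gen E `<=` supported (J m).
Proof.
move=> Em; apply: gen_sub => // _ [c Ec <-] t nJ; apply: fA => /(AJ (Em _ Ec)).
exact: nJ.
Qed.

Let GenS m E : Gen (m |` E) `<=` generated_subgroup (f m |` Gen E).
Proof.
apply: gen_mono => _ [c [->|Ec] <-]; first by left.
by right; apply: sub_gen; exists c.
Qed.

Let decomp m E g : (forall c, E c -> (c < m)%O) -> Gen (m |` E) g ->
  exists k p, WB m (Gen E) p /\ g = (zexpg (f m) k * p)%g.
Proof.
move=> Em /GenS/(gen_wreath_decomp (xy m) (yf m) (sGen E) (GenJ Em)).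
by case=> k [p gE]; exists k, p.
Qed.

(** * Finite sets of bumps and local solvability *)

Let Gen_fin g : G g -> exists2 E, finite_set E & Gen E g.
Proof.
move: g; apply: gen_sub; last first.
  by move=> _ [c _ <-]; exists [set c] => //; apply: sub_gen; exists c.
have mono E E' : E `<=` E' -> Gen E `<=` Gen E'.
  by move=> EE'; apply: gen_mono => _ [c /EE' Ec <-]; exists c.
apply/subgroupP; split.
- by exists set0 => //; apply: subgroup1; exact: sGen.
- move=> g h [E fE Eg] [E' fE' Eh]; exists (E `|` E'); first by rewrite finite_setU.
  apply: (subgroupM (sGen _)); [apply: mono Eg|apply: mono Eh]; exact: subsetUl || exact: subsetUr.
- by move=> g [E fE Eg]; exists E => //; exact: subgroupV (sGen _) _.
Qed.

Let Gen0 : Gen set0 `<=` [set 1%g].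
Proof. by apply: gen_sub; [exact: subgroup_set1|move=> _ [c []]]. Qed.

(** A finitely generated subgroup involves only finitely many bumps, and finitely many bumps
    generate a solvable group, as seen by adding them from the lowest up. *)
Lemma tower_locally_solvable : locally_solvable G.
Proof.
have solE : forall E, finite_set E -> solvable_subgroup (Gen E).
  apply: finite_set_max_ind.
    exists 0%N => /=; apply/seteqP; split; first exact: Gen0.
    by move=> _ ->; apply: subgroup1; exact: sGen.
  move=> m E _ Em solE.
  have [n Hn] := solvable_gen_wreath (xy m) (yf m) (sGen E) (GenJ Em) solE.
  exists n; apply/seteqP; split.
    by rewrite -Hn; apply: iter_derived_mono; exact: GenS.
  by move=> _ ->; apply: subgroup1; apply: subgroup_iter_derived; exact: sGen.
move=> K sK KG [S fS KE].
have /choice[F FP] g : exists E, finite_set E /\ (S g -> Gen E g).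
  have [Sg|nS] := pselect (S g); last by exists set0.
  have [|E fE Eg] := @Gen_fin g; last by exists E.
  by apply: KG; rewrite KE; exact: sub_gen.
have [n Hn] : solvable_subgroup (Gen (\bigcup_(g in S) F g)).
  by apply: solE; apply: bigcup_finite => // g _; exact: (FP g).1.
exists n; apply/seteqP; split; last first.
  by move=> _ ->; apply: subgroup1; exact: subgroup_iter_derived.
rewrite -Hn; apply: iter_derived_mono; rewrite KE; apply: gen_sub.
  exact: sGen.
move=> g Sg; have := (FP g).2 Sg; apply: gen_mono => _ [c Fc <-].
by exists c => //; exists g.
Qed.

(** * How an element acts on one support *)

Let suppA c : subgroup (supported (A c)). Proof. exact: subgroup_supported. Qed.

Let fZA c k t : A c t -> A c (zexpg (f c) k t).
Proof.
by move=> At; apply: supported_in => //; apply: (subgroupZX _ (suppA c)); exact: fA.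
Qed.

(** Induct on the largest bump [f m] involved in [g]. If [m < e], all of [g] lives in [J e]; if
    [m = e], this is the normal form; if [m > e], then [A e] lies in [J m], which [g] either moves
    to another block or acts on by a component over smaller bumps. *)
Let act g e : G g -> (forall t, A e t -> ~ A e (g t)) \/
  exists k p, WB e (supported (J e)) p /\
    forall t, A e t -> g t = p (zexpg (f e) k t).
Proof.
move=> /Gen_fin[E fE]; move: E fE g.
apply: (@finite_set_max_ind _ _ (fun E => forall g, Gen E g -> _)).
  move=> _ /Gen0 ->; right; exists 0, 1%g; split=> //.
  by apply: subgroup1; exact: subgroup_wreath_base.
move=> m E _ Em IH g Eg; have [me|em|me] := ltgtP m e.
- right; exists 0, g; split=> //; apply: sub_wreath_base => //.
  apply: GenJ Eg => c [->//|/Em cm]; exact: lt_trans cm me.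
- have [k [p [pP ->]]] := decomp Em Eg.
  have [k0|k0] := eqVneq k 0.
    have [h Eh hE] := pP.1 0.
    have gh t : A e t -> (zexpg (f m) k * p)%g t = h t.
      by move=> /(AJ em) Jt; rewrite PLo_mulE k0; exact: hE.
    have [hA|[l [q [qP hq]]]] := IH h Eh.
      by left=> t At; rewrite gh//; exact: hA.
    by right; exists l, q; split=> // t At; rewrite gh// hq.
  left=> t /(AJ em) Jt /(AJ em) Jgt.
  have [h Eh hE] := pP.1 k; rewrite PLo_mulE hE// in Jgt.
  have Jht : J m (h t) by apply: supported_in => //; exact: GenJ Eh.
  have [kE _] := block_inj (xy m) (yf m) Jht Jgt (erefl : zexpg (f m) k (h t) = zexpg (f m) 0 _).
  by rewrite kE eqxx in k0.
- have [k [p [pP ->]]] := decomp Em Eg; subst e.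
  right; exists k, p; split=> //; apply: wreath_base_mono pP; exact: GenJ.
Qed.

(** Bumps up to [c] fix [a c], so a bump above [c] must act with nonzero exponent. It is found by
    following, from the top bump down, the component that acts at [a c]. *)
Let desc g c : G g -> g (a c) <> a c -> exists e k p,
  [/\ (c < e)%O, k != 0, WB e (supported (J e)) p &
      forall t, A e t -> g t = p (zexpg (f e) k t)].
Proof.
move=> /Gen_fin[E fE Eg] gc.
(* Membership of [e] in [E] is carried along so that [A e] lies in [J m], where [g] agrees with its
   component [h]. *)
suff: exists e k p, [/\ E e /\ (c < e)%O, k != 0, WB e (supported (J e)) p &
    forall t, A e t -> g t = p (zexpg (f e) k t)].
  by case=> e [k [p [[_ ce] k0 pP gE]]]; exists e, k, p.
move: E fE g Eg gc.
apply: (@finite_set_max_ind _ _ (fun E => forall g, Gen E g -> _)).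
  by move=> _ /Gen0 ->.
move=> m E _ Em IH g Eg gc; have [mc|cm] := leP m c.
  case: gc; suff : supported (A c) g by apply; rewrite /A ltxx.
  move: Eg; apply: gen_sub => // _ [e ee <-] t nA; apply: fA => At; apply: nA.
  have [<-//|ec] := eqVneq e c; apply: JA; apply: (@AJ e c) => //.
  rewrite lt_neqAle ec; case: ee => [->//|/Em em]; exact: le_trans (ltW em) mc.
have [k [p [pP gE]]] := decomp Em Eg.
have [k0|k0] := eqVneq k 0; last first.
  exists m, k, p; split=> //; first by split=> //; left.
    apply: wreath_base_mono pP; exact: GenJ.
  by move=> t _; rewrite gE.
have [h Eh hE] := pP.1 0.
have gh t : J m t -> g t = h t by move=> Jt; rewrite gE PLo_mulE k0; exact: hE.
have [|e [l [q [[Ee ce] l0 qP hq]]]] := IH h Eh.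
  by rewrite -gh//; exact: Ja.
exists e, l, q; split=> //; first by split=> //; right.
by move=> t At; rewrite gh ?hq//; apply: AJ At; exact: Em.
Qed.

(** * Stabilizers of the translates of an endpoint *)

Let fix_of c : set (PLo R) :=
  [set g | G g /\ forall w, G w -> g (w (a c)) = w (a c)].

(** If [f e] moved [w (a c)], then [w * f e * w^-1] would move [a c], hence shift the blocks of some
    [e' > c] by [desc]. But [f e] lives in [J e']; so [w (a c)] is in [J e'], [w] has shift 0 there,
    and the conjugate keeps [a c] in [J e']. *)
Let f_fix_of c e : (e <= c)%O -> fix_of c (f e).
Proof.
move=> ec; split=> // w Gw; apply: contrapT => wc.
have Gg : G (w * f e * w^-1)%g.
  by apply: (subgroupM sG); [exact: (subgroupM sG)|exact: (subgroupV sG)].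
have [|e' [k [p [ce k0 pP gE]]]] := desc (c := c) Gg.
  by rewrite !PLo_mulE => H; apply: wc; rewrite -[RHS](congr1 w H) PLo_VK.
have fJ : supported (J e') (f e).
  by move=> t nJ; apply: fA => /(AJ (le_lt_trans ec ce)).
have Jc := Ja ce.
have [wA|[l [q [qP wE]]]] := act e' Gw.
  apply: wc; apply: fJ => /JA; apply: wA; exact: JA.
have [h hJ hE] := pP.1 k; have [h' h'J h'E] := qP.1 l.
have wE' : w (a c) = zexpg (f e') l (h' (a c)) by rewrite wE ?h'E//; exact: JA.
have Jwa : J e' (w (a c)) by apply: contrapT => /fJ.
have Jh'a : J e' (h' (a c)) by exact: supported_in.
have [l0 _] := block_inj (xy e') (yf e') Jh'a Jwa
  (esym wE' : _ = zexpg (f e') 0 (w (a c))).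
set u := f e (w (a c)); have Ju : J e' u by exact: supported_in.
have Js : J e' (h'^-1%g u) by apply: supported_in => //; exact: (subgroupV (sSJ _)).
have wu : w^-1%g u = h'^-1%g u.
  apply: PLo_VE; rewrite wE ?l0; last exact: JA.
  by have := h'E _ Js; rewrite l0 PLo_VK => ->.
have gE' : w^-1%g u = zexpg (f e') k (h (a c)).
  by rewrite -hE// -gE//; exact: JA.
have [k0' _] := block_inj (xy e') (yf e') (supported_in hJ Jc) Js
  (etrans (esym gE') wu : _ = zexpg (f e') 0 (h'^-1%g u)).
by rewrite k0' eqxx in k0.
Qed.

Let f_nfix_of c e : (c < e)%O -> ~ fix_of c (f e).
Proof.
move=> ce [_ /(_ _ (subgroup1 sG))]; rewrite PLo_oneE => fea.
by have := fgt (JA (Ja ce)); rewrite fea ltxx.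
Qed.

(** For the centralizer clause, suppose that [h] moves [a c]. Then [h] shifts the blocks of some
    [e > c], while [g] has shift 0 and is trivial on a far block. A conjugate of [f c] living in
    that block commutes with [g] but not with [h]. *)
Let fix_of_closed c : centralizer_closed G (fix_of c).
Proof.
split.
- apply/subgroupP; split.
  + by split=> //; exact: subgroup1.
  + move=> g h [Gg gc] [Gh hc]; split; first exact: (subgroupM sG).
    by move=> w Gw; rewrite PLo_mulE gc// hc.
  + move=> g [Gg gc]; split; first exact: (subgroupV sG).
    by move=> w Gw; apply: PLo_Vfix; exact: gc.
- by move=> g [].
- move=> g h Gh [Gg gc]; split; first exact: (subgroupJ sG).
  move=> w Gw; rewrite /conjg !PLo_mulE.
  have -> : h^-1%g (w (a c)) = (w * h^-1)%g (a c) by [].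
  by rewrite gc ?PLo_mulE ?PLo_VK//; apply: (subgroupM sG) => //; exact: (subgroupV sG).
- move=> g n Gg [_ gc]; split=> // w Gw; apply: (@PLo_Xfix_inv _ _ n); exact: gc.
move=> g0 h0 [Gg0 g0c] Gh0 gh0; split=> // w Gw; apply: contrapT => h0w.
have Gw' : G w^-1%g by exact: (subgroupV sG).
have wgE r t : (r ^ w^-1)%g t = w^-1%g (r (w t)) by rewrite /conjg invgK !PLo_mulE.
(* Conjugation by [w^-1] replaces the translate [w (a c)] by [a c] itself. *)
pose g := (g0 ^ w^-1)%g; pose h := (h0 ^ w^-1)%g.
have Gg : G g by exact: (subgroupJ sG).
have Gh : G h by exact: (subgroupJ sG).
have gh z : G z -> commute z g -> commute z h.
  move=> Gz zg; have zJ r : commute z (r ^ w^-1)%g <-> commute (z ^ w)%g r.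
    rewrite /commute; split=> e; last first.
      by rewrite -[z](conjgK w) -!conjMg e.
    by rewrite -[r](conjgKV w) -!conjMg e.
  by apply/zJ; apply: gh0; [exact: (subgroupJ sG)|exact/zJ].
have ha : h (a c) <> a c.
  by rewrite wgE => H; apply: h0w; rewrite -[RHS](congr1 w H) PLo_VK.
have [e [k [p [ce k0 pP hE]]]] := desc Gh ha.
have ga i : g (zexpg (f e) i (a c)) = zexpg (f e) i (a c).
  rewrite wgE; apply: PLo_VE.
  have -> : w (zexpg (f e) i (a c)) = (zexpg (f e) i * w)%g (a c) by [].
  by rewrite g0c//; apply: (subgroupM sG) => //; exact: (subgroupZX _ sG).
have Jc := Ja ce.
have [gA|[l [q [qP gE]]]] := act e Gg.
  by have := gA _ (JA Jc); case; have /= -> := ga 0; exact: JA.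
have [h' h'J h'E] := qP.1 l.
have l0 : l = 0.
  have e1 : zexpg (f e) l (h' (a c)) = zexpg (f e) 0 (a c).
    by rewrite -h'E// -gE; [exact: ga 0|exact: JA].
  by have [] := block_inj (xy e) (yf e) (supported_in h'J Jc) Jc e1.
(* Block [n] is the first one to the right of the window of [q], hence is fixed pointwise by [g]. *)
have [_ [n qn]] := qP.
pose B t := exists2 s, J e s & t = zexpg (f e) n s.
have gB t : B t -> g t = t.
  move=> [s Js tE]; rewrite gE ?l0; last by rewrite tE; apply: fZA; exact: JA.
  apply: contrapT => /qn[i [s' [iN Js' tE']]].
  have [ni _] := block_inj (xy e) (yf e) Js Js' (etrans (esym tE) tE').
  by move: iN; rewrite -ni; lia.
pose z := (f c ^ zexpg (f e) n)%g.
have Gz : G z by apply: (subgroupJ sG) => //; exact: (subgroupZX _ sG).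
have zE t : z (zexpg (f e) n t) = zexpg (f e) n (f c t).
  by rewrite /z /conjg !PLo_mulE PLo_KV.
have fcJ : supported (J e) (f c) by move=> t nJ; apply: fA => /(AJ ce).
have zB : supported B z.
  move=> t nB; have -> : t = zexpg (f e) n ((zexpg (f e) n)^-1%g t) by rewrite PLo_VK.
  rewrite zE fcJ// => Js; apply: nB; exists ((zexpg (f e) n)^-1%g t) => //.
  by rewrite PLo_VK.
have zg : commute z g.
  apply: PLo_eqP => t; change (g (z t) = z (g t)).
  have [Bt|nB] := pselect (B t); first by rewrite (gB _ Bt) gB//; exact: supported_in.
  rewrite [z t]zB// zB// => Bgt; apply: nB.
  by have /PLo_inj gt := gB _ Bgt; rewrite gt in Bgt.
have Jx : J e (x c) by apply: (AJ ce); rewrite /A ax /=; have := xy c; have := yb c; lra.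
(* The two products are compared at [v], which [z] moves, whereas [h v] lies in block [n + k],
   outside the support of [z]. *)
set v := zexpg (f e) n (x c).
have hz : h (z v) = z (h v) := congr1 (fun r : PLo R => r v) (gh z Gz zg).
rewrite zE in hz.
have zhv : z (h v) = h v.
  apply: zB => -[s Js hvE]; have [r rJ rE] := pP.1 (n%:Z + k).
  have hv : h v = zexpg (f e) (n%:Z + k) (r (x c)).
    by rewrite hE ?PLo_zexpD ?rE -?PLo_zexpD ?rE//; apply: fZA; exact: JA.
  have [nk _] := block_inj (xy e) (yf e) (supported_in rJ Jx) Js (etrans (esym hv) hvE).
  by move: k0; rewrite -[k](addKr n%:Z) nk addNr eqxx.
rewrite zhv in hz; have /PLo_inj fxc := PLo_inj hz.
have : x c < f c (x c) by apply: fgt; rewrite /A ax /=; have := xy c; have := yb c; lra.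
by rewrite fxc ltxx.
Qed.

Let f_leP c e : closure_le G (f c) (f e) -> (c <= e)%O.
Proof.
move=> ce; rewrite leNgt; apply/negP => /f_nfix_of; apply.
by apply: ce; [exact: fix_of_closed|exact: f_fix_of].
Qed.

(** * Centralizers and the level of an element *)

Let WBJ m p t : WB m (supported (J m)) p -> J m (p t) <-> J m t.
Proof.
have sWB := subgroup_wreath_base (xy m) (yf m) (sSJ m) (@subset_refl _ _).
have JJ q s : WB m (supported (J m)) q -> J m s -> J m (q s).
  by case=> /(_ 0)[h hJ hE] _ Js; rewrite (hE s Js); exact: (supported_in hJ Js).
move=> pP; split; last exact: JJ.
by move=> /(JJ _ _ (subgroupV sWB pP)); rewrite PLo_KV.
Qed.

(** Here [q] is the leftmost component of [v]. Whatever commutes with [v] permutes the points moved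
    by [v], so neither it nor its inverse can shift [J m] to the left; it therefore preserves [J m]
    and commutes with [q]. *)
Let peel m v q : G v -> supported (J m) q -> (forall t, J m t -> v t = q t) ->
  (forall t, v t <> t -> x m < t /\ A m t) ->
  forall z, G z -> commute z v -> commute z q.
Proof.
move=> Gv qJ vq vA z Gz zv.
have zvE t : v (z t) = z (v t) := congr1 (fun r : PLo R => r t) zv.
have vz t : v t <> t -> v (z t) <> z t by rewrite zvE => vt /PLo_inj.
have vzV t : v t <> t -> v (z^-1%g t) <> z^-1%g t.
  move=> vt e; apply: vt; have := zvE (z^-1%g t).
  by rewrite PLo_VK e PLo_VK.
have [q1|/existsNP[t0 qt0]] := pselect (forall t, q t = t).
  by have -> : q = 1%g; [exact: PLo_eqP|exact: commute1].
have Jt0 : J m t0 by apply: contrapT => /qJ.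
have vt0 : v t0 <> t0 by rewrite vq.
have [zA|[k [p [pP zE]]]] := act m Gz.
  by case: (zA t0 (JA Jt0)); exact: (vA _ (vz _ vt0)).2.
have k0 : k = 0.
  have [h hJ hE] := pP.1 k.
  case: (ltgtP k 0) => // k0.
  - have [+ _] := vA _ (vz _ vt0); rewrite zE ?hE//; last exact: JA.
    by rewrite ltNge (block_le (xy m) (yf m) (supported_in hJ Jt0)) ?k0.
  - have [xu Au] := vA _ (vzV _ vt0).
    have := zE _ Au; rewrite PLo_VK => t0E.
    have Js : J m (zexpg (f m) k (z^-1%g t0)) by apply/(WBJ _ pP); rewrite -t0E.
    have := block_le (xy m) (yf m) Js (_ : - k < 0).
    by rewrite -PLo_zexpD addrN oppr_lt0 => /(_ k0); rewrite leNgt xu.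
have zJ t : J m t -> J m (z t).
  by move=> Jt; rewrite zE ?k0; [apply/(WBJ _ pP)|exact: JA].
apply: PLo_eqP => t; change (q (z t) = z (q t)).
have [Jt|nJ] := pselect (J m t); first by rewrite -!vq ?zvE//; exact: zJ.
rewrite (qJ t nJ) qJ// => Jzt.
have sWB := subgroup_wreath_base (xy m) (yf m) (sSJ m) (@subset_refl _ _).
have Js : J m (p^-1%g (z t)) by apply/(WBJ _ (subgroupV sWB pP)).
apply: nJ; have zs : z (p^-1%g (z t)) = z t.
  by rewrite zE ?k0; [exact: PLo_VK|exact: JA].
by rewrite -(PLo_inj zs).
Qed.

(* If [g] shifts the fundamental domain of [f m], then [f c] is recovered from
   the commutator of [f c] and [g], whose leftmost part is [f c]^-1. *)
Let lower N m k p g : centralizer_closed G N -> k != 0 -> G g ->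
  WB m (supported (J m)) p -> g = (zexpg (f m) k * p)%g -> N g ->
  forall c, (c < m)%O -> N (f c).
Proof.
move=> NP; have [sN NG NJ NX NC] := NP.
have pos k' p' g' : 0 < k' -> G g' -> WB m (supported (J m)) p' ->
    g' = (zexpg (f m) k' * p')%g -> N g' -> forall c, (c < m)%O -> N (f c).
  move=> k0 Gg pP gE Ng c cm.
  rewrite -[f c]invgK; apply: (subgroupV sN).
  have fcJ : supported (J m) (f c) by move=> t nJ; apply: fA => /(AJ cm).
  have fcVJ := subgroupV (sSJ m) fcJ.
  (* As [f c] lives in [J m], its conjugate lives in block [k'], to the right of [J m]. *)
  have cgA t : (f c ^ g')%g t <> t -> exists2 s, J m s & t = zexpg (f m) k' s.
    move=> ct; have Js : J m (g'^-1%g t).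
      apply: contrapT => /fcJ e; apply: ct.
      by rewrite /conjg !PLo_mulE e PLo_VK.
    have [h hJ hE] := pP.1 k'.
    exists (h (g'^-1%g t)); first exact: supported_in.
    rewrite -hE// -[LHS](PLo_VK g') gE; exact: PLo_mulE.
  have Jnot t s : J m t -> J m s -> t <> zexpg (f m) k' s.
    by move=> Jt Js e; have := block_lt (xy m) (yf m) k0 Jt Js; rewrite -e ltxx.
  pose v := ((f c)^-1 * f c ^ g')%g.
  have Nv : N v.
    (* As a commutator with [g'], [v] is a conjugate of [g'^-1] times [g']. *)
    rewrite /v -/(commg _ _) commgEr; apply: (subgroupM sN) => //.
    by apply: NJ => //; exact: (subgroupV sN).
  apply: (NC v) => //; first exact: (subgroupV sG).
  apply: (peel (m := m)) => //; first exact: NG.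
  - move=> t Jt; rewrite PLo_mulE; apply: contrapT => /cgA[s Js].
    by apply: Jnot => //; exact: supported_in.
  - move=> t vt; have [Jt|nJ] := pselect (J m t).
      by split; [case/andP: Jt|exact: JA].
    have /cgA[s Js ->] : (f c ^ g')%g t <> t by move: vt; rewrite PLo_mulE fcVJ.
    split; last by apply: fZA; exact: JA.
    by have := block_lt (xy m) (yf m) k0 (J0 m) Js; apply: lt_trans; case/andP: (J0 m).
move=> k0 Gg pP gE Ng c cm.
have sWB := subgroup_wreath_base (xy m) (yf m) (sSJ m) (@subset_refl _ _).
case: (ltgtP k 0) k0 => // k0 _; last exact: (pos k p g).
(* A negative shift is made positive by passing to [g^-1], whose normal form has exponent [- k]. *)
apply: (pos (- k) (p^-1 ^ zexpg (f m) (- k))%g g^-1%g) => //.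
- by rewrite oppr_gt0.
- exact: (subgroupV sG).
- exact: (wreath_base_conj (xy m) (yf m) _ (subgroupV sWB pP)).
- by rewrite gE /conjg mulVKg zexpgN invgM.
- exact: (subgroupV sN).
Qed.

Let f_le c e : (c <= e)%O -> closure_le G (f c) (f e).
Proof.
rewrite le_eqVlt => /predU1P[-> //|ce] N NP Ne.
have sWB := subgroup_wreath_base (xy e) (yf e) (sSJ e) (@subset_refl _ _).
apply: (lower (m := e) (k := 1) (p := 1%g) NP _ (Gf e) _ _ Ne) => //.
  exact: subgroup1 sWB.
by rewrite zexpg1 mulg1.
Qed.

(** The level [c] is [m] if the exponent [k] of the top bump is nonzero, and otherwise the largest
    level among the nontrivial components of [p]. *)
Lemma tower_level g : G g -> g != 1%g ->
  exists c, closure_le G g (f c) /\ closure_le G (f c) g.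
Proof.
move=> /Gen_fin[E fE]; move: E fE g.
apply: (@finite_set_max_ind _ _ (fun E => forall g, Gen E g -> _)).
  by move=> _ /Gen0 ->; rewrite eqxx.
move=> m E _ Em IH g Eg g1.
have Gg := GenG Eg; have [k [p [pP gE]]] := decomp Em Eg.
have pJ : WB m (supported (J m)) p by apply: wreath_base_mono pP; exact: GenJ.
have Gp : G p.
  have -> : p = (zexpg (f m) (- k) * g)%g by rewrite gE zexpgN mulKg.
  by apply: (subgroupM sG) => //; exact: (subgroupZX _ sG).
have GJ h : G h -> G (h ^ f m)%g /\ G (h ^ (f m)^-1)%g.
  by move=> Gh; split; apply: (subgroupJ sG) => //; exact: (subgroupV sG).
have NJE N h : centralizer_closed G N -> (N (h ^ f m)%g <-> N h) /\ (N (h ^ (f m)^-1)%g <-> N h).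
  move=> [_ _ NJ _ _]; split; split=> Nh.
  - by rewrite -[h](conjgK (f m)); apply: NJ => //; exact: (subgroupV sG).
  - exact: NJ.
  - by rewrite -[h](conjgKV (f m)); apply: NJ.
  - by apply: NJ => //; exact: (subgroupV sG).
have [k0|k0] := eqVneq k 0; last first.
  exists m.
  (* [p] is built by products and shifts from components in [Gen E], so [N] contains it once it
     contains the lower bumps. *)
  have pN N : centralizer_closed G N -> (forall c, (c < m)%O -> N (f c)) -> N p.
    move=> NP fN; have [sN NG NJ _ _] := NP.
    have EN : Gen E `<=` N by apply: gen_sub => // _ [c /Em/fN Nc <-].
    move: p pP {gE pJ Gp}.
    apply: (@wreath_base_ind _ _ _ _ (xy m) (yf m) _ N (sGen E) (GenJ Em)).
    - exact: (subgroup1 sN).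
    - by move=> h; rewrite (NJE N h NP).1.
    - by move=> h; rewrite (NJE N h NP).2.
    - by move=> h q /EN Nh _ _ Nq; exact: (subgroupM sN).
  split=> N NP; have [sN NG NJ NX _] := NP.
    move=> Nm; rewrite gE; apply: (subgroupM sN); first exact: (subgroupZX _ sN).
    by apply: pN => // c cm; apply: (f_le (ltW cm)) Nm.
  move=> Ng; have Np : N p by apply: pN => //; exact: (lower NP k0 Gg pJ gE Ng).
  have : N (zexpg (f m) k).
    by rewrite -[zexpg _ _](mulgK p) -gE; apply: (subgroupM sN) => //; exact: (subgroupV sN).
  (* [N] contains a nonzero power of [f m], inverted if the exponent is negative; closure under
     roots gives [f m]. *)
  case: k k0 {gE} => [[|n]|n] //= _; first exact: NX.
  by move=> /(subgroupV sN); rewrite invgK; exact: NX.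
have gp : g = p by rewrite gE k0 mul1g.
rewrite {}gp in Gg g1 *; move: Gp g1.
(* The identity has no level, so the induction admits it as an alternative. *)
suff : G p -> p = 1%g \/ exists c, closure_le G p (f c) /\ closure_le G (f c) p.
  by move=> H Gp p1; case: (H Gp) => // p1'; rewrite p1' eqxx in p1.
move: p pP {gE pJ Gg}.
pose P p := G p -> p = 1%g \/ exists c, closure_le G p (f c) /\ closure_le G (f c) p.
have PJ r h : (forall N, centralizer_closed G N -> N (h ^ r)%g <-> N h) ->
    (G h -> G (h ^ r)%g) -> P (h ^ r)%g -> P h.
  move=> hr Ghr Phr /Ghr/Phr[/(congr1 (fun u => u ^ r^-1)%g)|].
    by rewrite conjgK conj1g; left.
  move=> [c [hc ch]]; right; exists c.
  by split=> N NP Nh; [apply/(hr N NP)|]; [exact: hc|apply: ch => //; exact/hr].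
apply: (@wreath_base_ind _ _ _ _ (xy m) (yf m) _ P (sGen E) (GenJ Em)).
- by left.
- move=> h; apply: PJ; first by move=> N NP; exact: (NJE N h NP).1.
  by move=> Gh; exact: (GJ h Gh).1.
- move=> h; apply: PJ; first by move=> N NP; exact: (NJE N h NP).2.
  by move=> Gh; exact: (GJ h Gh).2.
move=> h q Eh qP qpos Pq Ghq.
have Gh : G h by exact: GenG Eh.
have Gq : G q by rewrite -[q](mulKg h); apply: (subgroupM sG) => //; exact: (subgroupV sG).
have hJ : supported (J m) h by exact: GenJ Eh.
(* By [peel], every [N] containing the product contains its leftmost component [h], hence also
   [q]. *)
have hqN N : centralizer_closed G N -> N (h * q)%g <-> N h /\ N q.
  move=> [sN NG NJ _ NC]; split=> [Nhq|[Nh Nq]]; last exact: (subgroupM sN).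
  suff Nh : N h.
    split=> //; rewrite -[q](mulKg h); apply: (subgroupM sN) => //.
    exact: (subgroupV sN).
  apply: (NC _ _ Nhq) => //; apply: (peel (m := m)) => //.
  - move=> t Jt; rewrite PLo_mulE; apply: contrapT => /qpos[i [s [i0 Js e]]].
    have Jht := supported_in hJ Jt.
    by have := block_lt (xy m) (yf m) i0 Jht Js; rewrite -e ltxx.
  - move=> t hqt; have [Jt|nJ] := pselect (J m t).
      by split; [case/andP: Jt|exact: JA].
    have /qpos[i [s [i0 Js ->]]] : q t <> t by move: hqt; rewrite PLo_mulE hJ.
    split; last by apply: fZA; exact: JA.
    by have := block_lt (xy m) (yf m) i0 (J0 m) Js; apply: lt_trans; case/andP: (J0 m).
have [h1|h1] := eqVneq h 1%g; first by rewrite h1 mul1g; exact: Pq.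
right; have [c [hc ch]] := IH h Eh h1.
have [q1|[e [qe eq]]] := Pq Gq; first by rewrite q1 mulg1; exists c.
(* The level of the product is the larger of the two levels. *)
have [ce|ec] := leP c e; [exists e|exists c]; split=> N NP.
- move=> Ne; apply/(hqN N NP); split; last exact: qe.
  by apply: hc => //; exact: (f_le ce) Ne.
- by move=> /(hqN N NP)[_]; exact: eq.
- move=> Nc; apply/(hqN N NP); split; first exact: hc.
  by apply: qe => //; apply: (f_le (ltW ec)) Nc.
- by move=> /(hqN N NP)[+ _]; exact: ch.
Qed.

Lemma tower_closure_leP c e : closure_le G (f c) (f e) <-> (c <= e)%O.
Proof. by split; [exact: f_leP|exact: f_le]. Qed.

Lemma tower_neq1 c : f c != 1%g.
Proof. by apply/eqP => fc; have := fgt (JA (J0 c)); rewrite fc ltxx. Qed.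

End tower_group.

(** * Recovery of the order from the group *)

Lemma isomorphic_tower_groups (R : realType) (d d' : Order.disp_t)
    (C : orderType d) (D : orderType d') (f : C -> PLo R) (a x y b : C -> R)
    (g : D -> PLo R) (a' x' y' b' : D -> R) :
  bump_tower f a x y b -> bump_tower g a' x' y' b' ->
  isomorphic_subgroups (generated_subgroup (range f)) (generated_subgroup (range g)) ->
  order_isomorphic C D.
Proof.
move=> fT gT [t tbij tM].
set G := generated_subgroup (range f) in tbij tM.
set G' := generated_subgroup (range g) in tbij tM.
have sG : subgroup G by exact: subgroup_gen.
have sG' : subgroup G' by exact: subgroup_gen.
have Gf c : G (f c) by apply: sub_gen; exists c.
have Gg e : G' (g e) by apply: sub_gen; exists e.
have tG h : G h -> G' (t h) by case: tbij => + _ _; exact.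
have [t' [tbij' tM' tK t'K]] := isom_inverse sG sG' tbij tM.
have tG' h : G' h -> G (t' h) by case: tbij' => + _ _; exact.
have leE h k : G h -> G k -> closure_le G' (t h) (t k) <-> closure_le G h k.
  move=> Gh Gk; split; first exact: (isom_closure_le sG).
  by rewrite -{1}(tK h)// -{1}(tK k)//; apply: (isom_closure_le sG' tbij' tM'); exact: tG.
have t1 := isom1 sG tM; have t'1 := isom1 sG' tM'.
(* [phi c] is the level of the image of [f c]. By [tower_closure_leP] levels are unique and ordered
   as the index set, so the levels [psi] of the inverse images invert [phi]. *)
have /choice[phi phiP] c : exists e,
    closure_le G' (t (f c)) (g e) /\ closure_le G' (g e) (t (f c)).
  apply: (tower_level gT); first exact: tG.
  apply: contra (tower_neq1 fT c) => /eqP tfc.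
  by rewrite -(tK _ (Gf c)) tfc t'1.
have /choice[psi psiP] e : exists c,
    closure_le G (t' (g e)) (f c) /\ closure_le G (f c) (t' (g e)).
  apply: (tower_level fT); first exact: tG'.
  apply: contra (tower_neq1 gT e) => /eqP tge.
  by rewrite -(t'K _ (Gg e)) tge t1.
have phi_mono : {mono phi : c e / (c <= e)%O}.
  move=> c e; apply/idP/idP => ce.
    apply/(tower_closure_leP fT)/leE => //.
    apply: closure_le_trans (phiP c).1 _; apply: closure_le_trans (phiP e).2.
    exact/(tower_closure_leP gT).
  apply/(tower_closure_leP gT).
  apply: closure_le_trans (phiP c).2 _; apply: closure_le_trans (phiP e).1.
  exact/leE/(tower_closure_leP fT).
have phiK : cancel psi phi.
  move=> e; have Gt := tG' _ (Gg e); apply/le_anti/andP; split; apply/(tower_closure_leP gT).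
    apply: closure_le_trans (phiP _).2 _; rewrite -[X in closure_le _ _ X]t'K//.
    by apply/leE => //; exact: (psiP e).2.
  apply: closure_le_trans (phiP _).1; rewrite -[X in closure_le _ X _]t'K//.
  by apply/leE => //; exact: (psiP e).1.
exists phi => //; exists psi => // c; apply: (inc_inj phi_mono); exact: phiK.
Qed.

(** * The tower of supports *)

Section towers.
Variables (R : realType) (d : Order.disp_t) (C : orderType d).
Variables (f : C -> PLo R) (a x y b : C -> R).
Hypothesis fT : bump_tower f a x y b.

Let A c : set R := [set t | a c < t < b c].

Let A_mono c e : (c <= e)%O <-> A c `<=` A e.
Proof.
have [dom _ _ nest] := fT; split=> [|Ace].
  rewrite le_eqVlt => /predU1P[->//|/nest[xa by_] t].
  by have [ax xy yb _] := dom e; rewrite /A /=; lra.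
rewrite leNgt; apply/negP => /nest[xa by_].
have [ax xy yb _] := dom c.
have : A e (x c) by apply: Ace; rewrite /A /=; lra.
by rewrite /A /=; lra.
Qed.

Let A_inj c e : A c = A e -> c = e.
Proof. by move=> ce; apply/le_anti/andP; split; apply/A_mono; rewrite ce. Qed.

Lemma bump_tower_tower : exists T : set (set R * PLo R),
  [/\ tower (generated_subgroup (range f)) T, tower_order_isomorphic T C &
      generated_subgroup (range f) = generated_subgroup (signatures T)].
Proof.
have [dom supp up nest] := fT.
pose phi c := (A c, f c).
exists (range phi); split.
- split.
  + move=> _ _ [c _ [<- <-]]; split; last by apply: sub_gen; exists c.
    have AS t : A c t -> Supp (f c) t.
      move=> /up ft; have fct : f c t <> t by move=> e; rewrite e ltxx in ft.
      split=> //; apply/negP => /negP t01.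
      by have [fid _ _ _ _] := PLo_homeo (f c); exact: fct (fid _ t01).
    split=> //.
    * by have [ax xy yb _] := dom c; exists (x c); rewrite /A /=; lra.
    * by move=> s t /= /andP[as_ _] /andP[_ tb] u /andP[su ut]; rewrite /A /=; lra.
    * move=> B _ BS AB; apply/seteqP; split=> // t /BS[_ ft].
      by apply: contrapT => At; apply: ft; exact: supp.
  + move=> _ _ _ _ [c _ [<- _]] [e _ [<- _]].
    have [ce|/ltW ec] := leP c e; [left|right]; exact: (A_mono _ _).1.
  + move=> B g h [c _ [BE <-]] [e _ [BE' <-]].
    by congr f; apply: A_inj; rewrite BE BE'.
- exists phi; last by move=> c e; exact: A_mono.
  split; first by move=> c _; exists c.
    by move=> c e _ _ [/A_inj].
  by move=> _ [c _ <-]; exists c.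
- congr generated_subgroup; apply/seteqP; split=> [_ [c _ <-]|_ [_ [c _ <-] <-]].
    by exists (phi c) => //; exists c.
  by exists c.
Qed.

End towers.

(** * Thompson's group *)

Section dyadics.
Variable R : realType.
Implicit Types (c m t u v x : R).
Local Notation dyadic := (@dyadic R).

Definition pow2 m : Prop := exists k : int, m = 2 ^ k.

Lemma pow2_gt0 m : pow2 m -> 0 < m.
Proof. by case=> k ->; exact: exprz_gt0. Qed.

Lemma pow21 : pow2 1. Proof. by exists 0. Qed.
Lemma pow22 : pow2 2. Proof. by exists 1. Qed.

Lemma pow2M m m' : pow2 m -> pow2 m' -> pow2 (m * m').
Proof. by move=> [k ->] [l ->]; exists (k + l); rewrite expfzDr. Qed.

Lemma pow2V m : pow2 m -> pow2 m^-1.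
Proof. by move=> [k ->]; exists (- k); rewrite invr_expz. Qed.

Lemma dyadic_int (k : int) : dyadic k%:~R.
Proof. by exists k, 0%N; rewrite expr0 divr1. Qed.

Lemma dyadicN t : dyadic t -> dyadic (- t).
Proof. by move=> [m [n ->]]; exists (- m), n; rewrite mulrNz mulNr. Qed.

Lemma dyadicD t u : dyadic t -> dyadic u -> dyadic (t + u).
Proof.
move=> [m [n ->]] [m' [n' ->]]; exists (m * 2 ^+ n' + m' * 2 ^+ n), (n + n')%N.
rewrite rmorphD !rmorphM !rmorphXn /= exprD.
by field; rewrite !expf_neq0.
Qed.

Lemma dyadicM t u : dyadic t -> dyadic u -> dyadic (t * u).
Proof.
move=> [m [n ->]] [m' [n' ->]]; exists (m * m'), (n + n')%N.
rewrite rmorphM /= exprD; by field; rewrite !expf_neq0.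
Qed.

Lemma dyadic_pow2 m : pow2 m -> dyadic m.
Proof.
move=> [[n|n] ->].
- by exists (2 ^+ n), 0%N; rewrite rmorphXn /= expr0 divr1.
- by exists 1, n.+1; rewrite div1r.
Qed.

Lemma dyadic_dense u v : u < v -> exists2 t, dyadic t & u < t < v.
Proof.
move=> uv; have [n nP] : exists n : nat, 2 ^- n < v - u :> R.
  have [n _ nP] := near_infty_natSinv_expn_lt (PosNum (ltac:(lra) : 0 < v - u)).
  by exists n; have := nP n (leqnn n); rewrite /= div1r.
have p0 : (0 : R) < 2 ^+ n by rewrite exprn_gt0.
exists ((Num.floor (u * 2 ^+ n) + 1)%:~R / 2 ^+ n).
  by exists (Num.floor (u * 2 ^+ n) + 1), n.
have := floor_le (u * 2 ^+ n); have := lt_succ_floor (u * 2 ^+ n).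
rewrite ltr_pdivlMr// ltr_pdivrMr// => -> /=; rewrite rmorphD /= => fu.
apply: (le_lt_trans (_ : _ <= u * 2 ^+ n + 1)); first by rewrite lerD2r.
have := nP; rewrite -(ltr_pM2r p0) mulVf ?gt_eqF//; lra.
Qed.

(* A local form of membership in [ThompsonF], stable under composition and
   inversion because dyadic affine maps preserve dyadic points both ways. *)
Definition locally_dyadic_at (g : R -> R) x : Prop :=
  exists m m' c c' e : R, [/\ [/\ pow2 m, pow2 m', dyadic c, dyadic c' & 0 < e],
    forall t, x <= t < x + e -> g t = m * t + c,
    forall t, x - e < t <= x -> g t = m' * t + c' &
    dyadic x \/ m = m' /\ c = c'].

Definition locally_dyadic g : Prop := forall x, locally_dyadic_at g x.

Lemma locally_dyadic_at_interior g x u v m c : pow2 m -> dyadic c ->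
  u < x < v -> (forall t, u <= t <= v -> g t = m * t + c) ->
  locally_dyadic_at g x.
Proof.
move=> pm dc /andP[ux xv] gE.
exists m, m, c, c, (Num.min (x - u) (v - x)); split; last by right.
- by split=> //; rewrite lt_min !subr_gt0 ux.
- by move=> t /andP[xt]; rewrite -ltrBlDl lt_min => /andP[_ tv]; apply: gE; lra.
- by move=> t /andP[]; rewrite ltrBlDr -ltrBlDl lt_min => /andP[ut _] tx; apply: gE; lra.
Qed.

Lemma locally_dyadic_at_break g x u v m m' c c' :
  [/\ pow2 m, pow2 m', dyadic c & dyadic c'] -> dyadic x -> u < x < v ->
  (forall t, u <= t <= x -> g t = m' * t + c') ->
  (forall t, x <= t <= v -> g t = m * t + c) ->
  locally_dyadic_at g x.
Proof.
move=> [pm pm' dc dc'] dx /andP[ux xv] gl gr.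
exists m, m', c, c', (Num.min (x - u) (v - x)); split; last by left.
- by split=> //; rewrite lt_min !subr_gt0 ux.
- by move=> t /andP[xt]; rewrite -ltrBlDl lt_min => /andP[_ tv]; apply: gr; lra.
- by move=> t /andP[]; rewrite ltrBlDr -ltrBlDl lt_min => /andP[ut _] tx; apply: gl; lra.
Qed.

(** At a non-dyadic point the two affine germs coincide, so breakpoints are dyadic; the derivative
    is read off the right germ. *)
Lemma locally_dyadic_ThompsonF (g : PLo R) :
  locally_dyadic g -> @ThompsonF R g.
Proof.
move=> gL; split=> [x [x01 ndg]|x x01 dg].
  have [m [m' [c [c' [e [[_ _ _ _ e0] gr gl [//|[mm' cc']]]]]]]] := gL x.
  subst m' c'; case: ndg.
  apply: (@affine_on_derivable _ _ (x - e / 2) (x + e / 2)); last lra.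
  exists m, c => t /=; rewrite in_itv /= => te.
  by have [xt|tx] := leP x t; [apply: gr|apply: gl]; lra.
have [m [m' [c [c' [e [[[k mE] _ _ _ e0] gr _ _]]]]]] := gL x.
exists k; rewrite -mE derive1E.
have dl : (fun h : R => h^-1 *: ((g \o shift x) h%:A - g x)) @ 0^' --> 'D_1 g x.
  exact: dg.
apply: (cvg_unique _ (cvg_dnbhs_at_right dl)) => //.
apply: cvg_near_cst; near=> h.
have h0 : 0 < h by near: h; exact: nbhs_right_gt.
have he : h < e by near: h; exact: nbhs_right_lt.
have hE : h%:A = h :> R by exact: mulr1.
rewrite hE /= gr; last by rewrite /=; lra.
rewrite (gr x); last by lra.
rewrite /GRing.scale /=; field; lra.
Unshelve. all: by end_near. Qed.

Lemma subgroup_locally_dyadic :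
  subgroup [set g : PLo R | locally_dyadic g].
Proof.
apply/subgroupP; split.
- move=> x; exists 1, 1, 0, 0, 1; split.
  + by split=> //; [exact: pow21|exact: pow21|exact: (dyadic_int 0)|exact: (dyadic_int 0)].
  + by move=> t _; rewrite PLo_oneE mul1r addr0.
  + by move=> t _; rewrite PLo_oneE mul1r addr0.
  + by right.
- move=> f g fL gL x.
  have [m [m' [c [c' [e [[pm pm' dc dc' e0] fr fl fx]]]]]] := fL x.
  have [n [n' [q [q' [r [[pn pn' dq dq' r0] gr gl gx]]]]]] := gL (f x).
  have m0 := pow2_gt0 pm; have m'0 := pow2_gt0 pm'.
  have fxE : f x = m * x + c by apply: fr; lra.
  have fxE' : f x = m' * x + c' by apply: fl; lra.
  (* Dividing [r] by the slopes of [f] keeps the image within [r] of [f x]. *)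
  exists (n * m), (n' * m'), (n * c + q), (n' * c' + q'), (Num.min e (Num.min (r / m) (r / m'))).
  split.
  + split; [exact: pow2M|exact: pow2M| | |].
    * by apply: dyadicD => //; apply: dyadicM => //; exact: dyadic_pow2.
    * by apply: dyadicD => //; apply: dyadicM => //; exact: dyadic_pow2.
    * by rewrite !lt_min e0 !divr_gt0.
  + move=> t /andP[xt]; rewrite -ltrBlDl !lt_min => /and3P[te trm _].
    rewrite ltr_pdivlMr// in trm.
    have ft : f t = m * t + c by apply: fr; lra.
    rewrite PLo_mulE gr; first by rewrite ft; ring.
    rewrite PLo_le xt ft fxE /=; nra.
  + move=> t /andP[+ tx]; rewrite ltrBlDr -ltrBlDl !lt_min => /and3P[te _ trm].
    rewrite ltr_pdivlMr// in trm.
    have ft : f t = m' * t + c' by apply: fl; lra.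
    rewrite PLo_mulE gl; first by rewrite ft; ring.
    rewrite PLo_le tx ft fxE' andbT; nra.
  (* At a non-dyadic [x] the map [f] has a single germ, with a dyadic affine inverse, so [f x] is
     not dyadic either. *)
  + have [dx|ndx] := pselect (dyadic x); first by left.
    right; case: fx => // -[<- <-]; case: gx => [dfx|[-> ->] //].
    case: ndx; have -> : x = m^-1 * (f x + - c) by rewrite fxE; field; lra.
    apply: dyadicM; first by apply: dyadic_pow2; exact: pow2V.
    by apply: dyadicD => //; exact: dyadicN.
- move=> f fL u; set x := f^-1%g u.
  have fxu : f x = u by rewrite /x PLo_VK.
  have [m [m' [c [c' [e [[pm pm' dc dc' e0] fr fl fx]]]]]] := fL x.
  have m0 := pow2_gt0 pm; have m'0 := pow2_gt0 pm'.
  have fxE : u = m * x + c by rewrite -fxu; apply: fr; lra.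
  have fxE' : u = m' * x + c' by rewrite -fxu; apply: fl; lra.
  have e1 : 0 < m * e by rewrite mulr_gt0.
  have e2 : 0 < m' * e by rewrite mulr_gt0.
  exists m^-1, m'^-1, (m^-1 * - c), (m'^-1 * - c'), (Num.min (m * e) (m' * e)).
  split.
  + split; [exact: pow2V|exact: pow2V| | |by rewrite lt_min e1].
    * by apply: dyadicM; [apply: dyadic_pow2; exact: pow2V|exact: dyadicN].
    * by apply: dyadicM; [apply: dyadic_pow2; exact: pow2V|exact: dyadicN].
  + move=> t /andP[ut]; rewrite -ltrBlDl !lt_min => /andP[te _].
    apply: PLo_VE; rewrite fr; first by field; lra.
    have -> : m^-1 * t + m^-1 * - c = x + m^-1 * (t - u) by rewrite fxE; field; lra.
    have : 0 <= m^-1 * (t - u) by rewrite mulr_ge0 ?invr_ge0 ?subr_ge0 // ltW.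
    have : m^-1 * (t - u) < e by rewrite mulrC ltr_pdivrMr// mulrC.
    lra.
  + move=> t /andP[+ tu]; rewrite ltrBlDr -ltrBlDl !lt_min => /andP[_ te].
    apply: PLo_VE; rewrite fl; first by field; lra.
    have -> : m'^-1 * t + m'^-1 * - c' = x - m'^-1 * (u - t) by rewrite fxE'; field; lra.
    have : 0 <= m'^-1 * (u - t) by rewrite mulr_ge0 ?invr_ge0 ?subr_ge0 // ltW.
    have : m'^-1 * (u - t) < e by rewrite mulrC ltr_pdivrMr// mulrC.
    lra.
  + case: fx => [dx|[-> ->]]; [left|by right].
    by rewrite fxE; apply: dyadicD => //; apply: dyadicM => //; exact: dyadic_pow2.
Qed.

End dyadics.

(** * Dyadic bumps and their powers *)

Section bump.
Variables (R : realType) (p q e : R).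
Hypothesis pqe : [/\ 0 <= p, q <= 1, 0 < e & 3 * e < q - p].
Implicit Types t u : R.

(** Slope 2 away from [p], translation by [e] in the middle, slope 1/2 into [q]. The condition
    [3 * e < q - p] leaves room for the middle piece. *)
Definition bump_fun t : R :=
  if t <= p then t else if t <= p + e then 2 * t - p
  else if t <= q - 2 * e then t + e else if t <= q then (t + q) / 2 else t.

Lemma bump_fun1 t : t <= p -> bump_fun t = t.
Proof. by rewrite /bump_fun => ->. Qed.

Lemma bump_fun2 t : p <= t <= p + e -> bump_fun t = 2 * t - p.
Proof.
case: pqe => _ _ ? ?; rewrite /bump_fun => tP; do ![case: leP => ?] => //; lra.
Qed.

Lemma bump_fun3 t : p + e <= t <= q - 2 * e -> bump_fun t = t + e.
Proof.
case: pqe => _ _ ? ?; rewrite /bump_fun => tP; do ![case: leP => ?] => //; lra.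
Qed.

Lemma bump_fun4 t : q - 2 * e <= t <= q -> bump_fun t = (t + q) / 2.
Proof.
case: pqe => _ _ ? ?; rewrite /bump_fun => tP; do ![case: leP => ?] => //; lra.
Qed.

Lemma bump_fun5 t : q <= t -> bump_fun t = t.
Proof.
case: pqe => _ _ ? ?; rewrite /bump_fun => tP; do ![case: leP => ?] => //; lra.
Qed.

Lemma bump_fun_gt t : p < t < q -> t < bump_fun t.
Proof.
case: pqe => _ _ ? ?; rewrite /bump_fun => tP; do ![case: ifPn; rewrite -?ltNge => ?]; lra.
Qed.

Lemma bump_fun_id t : ~ (p < t < q) -> bump_fun t = t.
Proof.
move=> /negP; rewrite negb_and -!leNgt => /orP[]; [exact: bump_fun1|exact: bump_fun5].
Qed.

Lemma bump_fun_PL : PL_homeo bump_fun.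
Proof.
have [? ? ? ?] := pqe.
have mono : {mono bump_fun : t u / t <= u}.
  apply: le_mono => t u tu; rewrite /bump_fun.
  by do ![case: ifPn; rewrite -?ltNge => ?]; lra.
apply/PL_homeoP; split.
- move=> t; rewrite in_itv /= => tP; apply: bump_fun_id.
  by apply/negP; lra.
- have /choice[g gK] u : exists t, bump_fun t = u.
    have [u1|u1] := leP u p; first by exists u; exact: bump_fun1.
    have [u2|u2] := leP u (p + 2 * e); first by exists ((u + p) / 2); rewrite bump_fun2; lra.
    have [u3|u3] := leP u (q - e); first by exists (u - e); rewrite bump_fun3; lra.
    have [u4|u4] := leP u q; first by exists (2 * u - q); rewrite bump_fun4; lra.
    by exists u; apply: bump_fun5; exact: ltW.
  by exists g => // t; apply: (inc_inj mono); rewrite gK.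
- exact: mono.
exists [:: p; p + e; q - 2 * e; q] => u v u0 uv v1 sN.
have N t : t \in [:: p; p + e; q - 2 * e; q] -> t <= u \/ v <= t.
  by move=> /sN; rewrite negb_and -!leNgt => /orP.
have [s1|s1] := N p ltac:(by rewrite !inE eqxx ?orbT); last first.
  by exists 1, 0 => t; rewrite /= in_itv /= => tP; rewrite bump_fun1; lra.
have [s2|s2] := N (p + e) ltac:(by rewrite !inE eqxx ?orbT); last first.
  by exists 2, (- p) => t; rewrite /= in_itv /= => tP; rewrite bump_fun2; lra.
have [s3|s3] := N (q - 2 * e) ltac:(by rewrite !inE eqxx ?orbT); last first.
  by exists 1, e => t; rewrite /= in_itv /= => tP; rewrite bump_fun3; lra.
have [s4|s4] := N q ltac:(by rewrite !inE eqxx ?orbT); last first.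
  by exists (1 / 2), (q / 2) => t; rewrite /= in_itv /= => tP; rewrite bump_fun4; lra.
by exists 1, 0 => t; rewrite /= in_itv /= => tP; rewrite bump_fun5; lra.
Qed.

Lemma bump_fun_dyadic : dyadic p -> dyadic q -> dyadic e ->
  locally_dyadic bump_fun.
Proof.
have [_ _ ? ?] := pqe.
move=> dp dq de.
have P1 := pow21 R; have P2 := pow22 R; have P12 := pow2V P2.
have d0 := dyadic_int R 0; have d2 := dyadic_pow2 P2.
have dNp := dyadicN dp; have dq2 : dyadic (2^-1 * q).
  by apply: dyadicM => //; exact: dyadic_pow2.
have dpe := dyadicD dp de.
have dqe : dyadic (q - 2 * e) by apply: dyadicD => //; apply: dyadicN; exact: dyadicM.
have g1 t : t <= p -> bump_fun t = 1 * t + 0%:~R by move=> /bump_fun1 ->; rewrite mul1r addr0.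
have g2 t : p <= t <= p + e -> bump_fun t = 2 * t + - p by exact: bump_fun2.
have g3 t : p + e <= t <= q - 2 * e -> bump_fun t = 1 * t + e.
  by move=> /bump_fun3 ->; rewrite mul1r.
have g4 t : q - 2 * e <= t <= q -> bump_fun t = 2^-1 * t + 2^-1 * q.
  by move=> /bump_fun4 ->; rewrite -mulrDr mulrC.
have g5 t : q <= t -> bump_fun t = 1 * t + 0%:~R by move=> /bump_fun5 ->; rewrite mul1r addr0.
move=> t; case: (ltgtP t p) => [tp|pt|->].
- apply: (@locally_dyadic_at_interior _ _ t (t - 1) p 1 0%:~R) => //; first lra.
  by move=> u uP; apply: g1; lra.
- case: (ltgtP t (p + e)) => [tpe|pet|->].
  + apply: (@locally_dyadic_at_interior _ _ t p (p + e) 2 (- p)) => //; lra.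
  + case: (ltgtP t (q - 2 * e)) => [tq|qt|->].
    * by apply: (@locally_dyadic_at_interior _ _ t (p + e) (q - 2 * e) 1 e) => //; lra.
    * case: (ltgtP t q) => [tq|{}qt|->].
      - by apply: (@locally_dyadic_at_interior _ _ t (q - 2 * e) q 2^-1 (2^-1 * q)) => //; lra.
      - apply: (@locally_dyadic_at_interior _ _ t q (t + 1) 1 0%:~R) => //; first lra.
        by move=> u uP; apply: g5; lra.
      - apply: (@locally_dyadic_at_break _ _ q (q - 2 * e) (q + 1) 1 2^-1 0%:~R (2^-1 * q)) => //; first lra.
        by move=> u uP; apply: g5; lra.
    * by apply: (@locally_dyadic_at_break _ _ (q - 2 * e) (p + e) q 2^-1 1 (2^-1 * q) e) => //; lra.
  + by apply: (@locally_dyadic_at_break _ _ (p + e) p (q - 2 * e) 1 2 e (- p)) => //; lra.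
- apply: (@locally_dyadic_at_break _ _ p (p - 1) (p + e) 2 1 (- p) 0%:~R) => //; first lra.
  by move=> u uP; apply: g1; lra.
Qed.

End bump.

(** A bump with small step [e] translates by [e] along [[x, y]], and a high power of it carries [x]
    past [y] with the same support. *)
Lemma dyadic_bump (R : realType) (p x y q : R) : dyadic p -> dyadic q ->
  0 <= p -> p < x -> x < y -> y < q -> q <= 1 ->
  exists g : PLo R, [/\ locally_dyadic g, forall t, ~ (p < t < q) -> g t = t,
    forall t, p < t < q -> t < g t & y <= g x].
Proof.
move=> dp dq p0 px xy yq q1.
(* These bounds on [e] give [p + e < x] and [y < q - 2 * e], so [[x, y]] lies in the translation
   piece. *)
have m0 : 0 < Num.min (x - p) ((q - y) / 2).
  by rewrite lt_min subr_gt0 px divr_gt0 ?subr_gt0.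
have [e de /andP[e0]] := dyadic_dense m0.
rewrite lt_min => /andP[ex ey].
have pqe : [/\ 0 <= p, q <= 1, 0 < e & 3 * e < q - p] by split=> //; lra.
pose h := MkPLo (bump_fun_PL pqe).
have hE t : h t = bump_fun p q e t by [].
have hid t : ~ (p < t < q) -> h t = t by move=> tP; rewrite hE (bump_fun_id pqe).
have hgt t : p < t < q -> t < h t by exact: (bump_fun_gt pqe).
have hge t : t <= h t.
  have [tP|tP] := pselect (p < t < q); first exact/ltW/hgt.
  by rewrite hid.
have hL : locally_dyadic h by exact: bump_fun_dyadic.
have hn n : x <= (h ^+ n)%g x /\ (y <= (h ^+ n)%g x \/ x + n%:R * e <= (h ^+ n)%g x).
  elim: n => [|n [xn IH]]; first by rewrite mul0r addr0; split=> //; right.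
  rewrite expgSr PLo_mulE; set u := (h ^+ n)%g x in xn IH *.
  have uh := hge u; split; first exact: le_trans uh.
  have [yu|uy] := leP y u; first by left; exact: le_trans uh.
  right; case: IH => [|un]; first by rewrite leNgt uy.
  rewrite hE (bump_fun3 pqe); last by lra.
  by rewrite -natr1 mulrDl mul1r; lra.
pose N := Num.bound ((y - x) / e).
have Ne : y - x < N%:R * e.
  by rewrite -ltr_pdivrMr//; apply: archi_boundP; rewrite divr_ge0 ?subr_ge0 ?ltW.
(* [N] steps reach [y]; the successor exponent has the form required by [PLo_Xgt]. *)
exists (h ^+ N.+1)%g; split.
- exact: (subgroupX _ (subgroup_locally_dyadic R) hL).
- by move=> t /hid; exact: PLo_Xfix.
- by move=> t /hgt; exact: PLo_Xgt.
- rewrite expgSr PLo_mulE; apply: le_trans (hge _).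
  by have [_ [//|]] := hn N; lra.
Qed.

(** * Realization of a countable order *)

Section order_embedding.
Variables (R : realType) (d : Order.disp_t) (C : orderType d) (i : C -> nat).
Hypothesis iinj : injective i.
Implicit Types (c : C) (n N : nat).

Let w n : R := 2 ^- n.+1.
Let below c n : bool := `[< exists2 c', i c' = n & (c' < c)%O >].
Let S c N : R := \sum_(n < N) (if below c n then w n else 0).

Let w0 n : 0 < w n. Proof. by rewrite invr_gt0 exprn_gt0. Qed.

Let sum_w N : \sum_(n < N) w n <= 1.
Proof.
suff -> : \sum_(n < N) w n = 1 - 2 ^- N by rewrite gerBl invr_ge0 exprn_ge0.
elim: N => [|N IH]; first by rewrite big_ord0 expr0 invr1 subrr.
by rewrite big_ord_recr /= IH /w exprS; field; rewrite expf_neq0.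
Qed.

(** As [c] is not below itself, the term of index [i c] is missing from [S c N] and accounts for the
    gap. *)
Let S_gap c (B : nat -> bool) N : (i c < N)%N -> B (i c) ->
  (forall n, below c n -> B n) ->
  S c N + w (i c) <= \sum_(n < N) (if B n then w n else 0).
Proof.
move=> cN Bc cB; rewrite /S (bigD1 (Ordinal cN)) //= [leRHS](bigD1 (Ordinal cN)) //= Bc.
have -> : below c (i c) = false.
  by apply/asboolP => -[c' /iinj ->]; rewrite ltxx.
rewrite /= add0r [leLHS]addrC lerD2l; apply: ler_sum => n _.
case: ifPn => [/cB -> //|_]; by case: ifP => // _; exact: ltW.
Qed.

Let S_mono c n N : (n <= N)%N -> S c n <= S c N.
Proof.
move=> nN; rewrite /S -(subnKC nN) big_split_ord /= lerDl.
by apply: sumr_ge0 => k _; case: ifP => // _; exact: ltW.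
Qed.

Let S_le c n : S c n + w (i c) <= 1.
Proof.
(* The partial sum is extended so that its range contains the index [i c]. *)
apply: (le_trans (y := S c (maxn n (i c).+1) + w (i c))).
  by rewrite lerD2r S_mono// leq_maxl.
apply: le_trans (sum_w (maxn n (i c).+1)).
by apply: (@S_gap c xpredT) => //; exact: leq_maxr.
Qed.

(* [s c] is the total weight of the elements below [c], where [c] has weight
   [2 ^- (i c).+1]. *)
Lemma order_gap_embedding : exists s w' : C -> R,
  [/\ forall c, 0 <= s c, forall c, 0 < w' c, forall c, s c + w' c <= 1 &
      forall c c', (c < c')%O -> s c + w' c <= s c'].
Proof.
pose s c := sup (range (S c)).
have ubS c : has_ubound (range (S c)).
  exists 1 => _ [n _ <-]; have := S_le c n; have := w0 (i c); lra.
have Ss c n : S c n <= s c by apply: ub_le_sup => //; exists n.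
have sle c r : (forall n, S c n <= r) -> s c <= r.
  move=> Sr; apply: ge_sup; first by exists (S c 0); exists 0%N.
  by move=> _ [n _ <-].
exists s, (w \o i); split=> //=.
- by move=> c; apply: le_trans (Ss c 0%N); rewrite /S big_ord0.
- by move=> c; rewrite -lerBrDr; apply: sle => n; rewrite lerBrDr.
- move=> c c' cc'; rewrite -lerBrDr; apply: sle => n; rewrite lerBrDr.
  apply: (le_trans (y := S c (maxn n (i c).+1) + w (i c))).
    by rewrite lerD2r S_mono// leq_maxl.
  apply: le_trans (Ss c' (maxn n (i c).+1)); apply: S_gap; first exact: leq_maxr.
    by apply/asboolP; exists c.
  move=> k /asboolP[c'' <- c''c]; apply/asboolP; exists c'' => //.
  exact: lt_trans c''c cc'.
Qed.

End order_embedding.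

Lemma bump_tower_exists (R : realType) (d : Order.disp_t) (C : orderType d) :
  countable [set: C] -> exists f (a x y b : C -> R),
    bump_tower f a x y b /\ forall c, locally_dyadic (f c).
Proof.
move=> /countable_injP[i iinj].
have [s [w [s0 w0 sw1 sw]]] :=
  @order_gap_embedding R d C i (in2TT iinj).
(* The supports []1 - b c, b c[] are symmetric about 1/2. Each [c] owns the gap from [lo c] to
   [lo c + w c / 2] in the right half; [y c] and then [b c] are taken inside it, so a larger [c]
   gives a wider interval. *)
pose lo c := 2^-1 + s c / 2.
have /choice[b bP] c : exists b, dyadic b /\ lo c + w c / 4 < b < lo c + w c / 2.
  have [|b db bP] := @dyadic_dense R (lo c + w c / 4) (lo c + w c / 2); last by exists b.
  by have := w0 c; lra.
pose y c := lo c + w c / 8.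
have hP c : [/\ 0 <= 1 - b c, 1 - b c < 1 - y c, 1 - y c < y c, y c < b c & b c <= 1].
  have [_ bc] := bP c; have wc := w0 c; have sc := s0 c; have swc := sw1 c.
  by rewrite /y /lo in bc *; split; lra.
have /choice[f fP] c : exists g : PLo R, [/\ locally_dyadic g,
    forall t, ~ (1 - b c < t < b c) -> g t = t,
    forall t, 1 - b c < t < b c -> t < g t & y c <= g (1 - y c)].
  have [h1 h2 h3 h4 h5] := hP c; apply: dyadic_bump => //; last exact: (bP c).1.
  by apply: dyadicD; [exact: (dyadic_int R 1)|apply: dyadicN; exact: (bP c).1].
exists f, (fun c => 1 - b c), (fun c => 1 - y c), y, b; split; last by move=> c; case: (fP c).
split.
- by move=> c; have [] := hP c; have [] := fP c; split.
- by move=> c; case: (fP c).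
- by move=> c; case: (fP c).
- move=> c c' cc'; have [_ bc] := bP c; have wc := w0 c'; have swc := sw c c' cc'.
  by rewrite /y /lo in bc *; split; lra.
Qed.

(* The group attached to [C] is chosen in this set, which depends only on the
   order type of [C]: isomorphic orders thus get equal groups. *)
Definition tower_groups (R : realType) (d : Order.disp_t) (C : orderType d) :
    set (set (PLo R)) :=
  [set H | exists f (a x y b : C -> R), [/\ bump_tower f a x y b,
     forall c, locally_dyadic (f c) & H = generated_subgroup (range f)]].

Lemma tower_groups_iso (R : realType) (d d' : Order.disp_t) (C : orderType d)
    (D : orderType d') :
  order_isomorphic C D -> @tower_groups R d C = @tower_groups R d' D.
Proof.
move=> [t [t' tK t'K] t_mono].
have lt_t := leW_mono t_mono.
have lt_t' : {mono t' : c e / (c < e)%O} by move=> c e; rewrite -lt_t !t'K.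
apply/seteqP; split=> _ [f [a [x [y [b [[dom supp up nest] fL ->]]]]]].
- exists (f \o t'), (a \o t'), (x \o t'), (y \o t'), (b \o t'); split=> //=.
    by split=> /= [c|c u|c u|c e]; [exact: dom|exact: supp|exact: up|rewrite -lt_t'; exact: nest].
  congr generated_subgroup; apply/seteqP; split=> _ [c _ <-]; last by exists (t' c).
  by exists (t c) => //=; rewrite tK.
- exists (f \o t), (a \o t), (x \o t), (y \o t), (b \o t); split=> //=.
    by split=> /= [c|c u|c u|c e]; [exact: dom|exact: supp|exact: up|rewrite -lt_t; exact: nest].
  congr generated_subgroup; apply/seteqP; split=> _ [c _ <-]; last by exists (t c).
  by exists (t' c) => //=; rewrite t'K.
Qed.

Theorem theorem1p5 (R : realType) :
  exists W : forall (d : Order.disp_t) (C : orderType d), set (PLo R),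
    (forall (d : Order.disp_t) (C : orderType d), countable [set: C] ->
      [/\ subgroup (W d C),
          W d C `<=` @ThompsonF R,
          locally_solvable (W d C) &
          exists T : set (set R * PLo R),
            [/\ tower (W d C) T,
                tower_order_isomorphic T C &
                W d C = generated_subgroup (signatures T)]]) /\
    (forall (d : Order.disp_t) (C : orderType d)
            (d' : Order.disp_t) (D : orderType d'),
      countable [set: C] -> countable [set: D] ->
      (isomorphic_subgroups (W d C) (W d' D) <-> order_isomorphic C D)).
Proof.
(* The default [set0] is returned only if there is no suitable bump tower over [C], which
   [bump_tower_exists] excludes for countable [C]. *)
pose W d (C : orderType d) := xget set0 (@tower_groups R d C).
have WP d (C : orderType d) : countable [set: C] -> tower_groups C (W d C).
  move=> /(bump_tower_exists R)[f [a [x [y [b [fT fL]]]]]]; apply: xgetPex.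
  by exists (generated_subgroup (range f)), f, a, x, y, b.
exists W; split=> [d C /WP|d C d' D cC cD].
  case=> f [a [x [y [b [fT fL ->]]]]]; split.
  - exact: subgroup_gen.
  - move=> g fg; apply: locally_dyadic_ThompsonF; move: g fg; apply: gen_sub.
      exact: subgroup_locally_dyadic.
    by move=> _ [c _ <-]; exact: fL.
  - exact: tower_locally_solvable fT.
  - exact: bump_tower_tower fT.
split; last first.
  (* Equal sets of candidates give the same chosen group, so the identity is an isomorphism. *)
  move=> /(tower_groups_iso R) CD; rewrite /W CD; exists id => //.
  by split=> [//|g h _ _ //|g gW]; exists g.
have [f [a [x [y [b [fT _ ->]]]]]] := WP d C cC.
have [g [a' [x' [y' [b' [gT _ ->]]]]]] := WP d' D cD.
exact: isomorphic_tower_groups fT gT.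
Qed.
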